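(* Let $N\geqslant 4$ and let $\mathcal C$ be a category of noncrossing $\{x,y\}$-coloured partitions ($x^{-1}=x$, $y^{-1}=y$) with $\pi(x,y)\notin\mathcal C$, which is not a free product, all of whose blocks have even size, and which contains a partition with a block of size at least four. Then there exist integers $d,n\geqslant 0$ with $n\mid d$ such that $\mathcal C=\mathcal C_{\Gamma_d,\Lambda_n,\{x,y\}}$, i.e. $\mathbb G_N(\mathcal C)=H_N^+(\Gamma_d,\Lambda_n)$, where $\Lambda_n\subset\Gamma_d$ is the subgroup generated by $(xy)^n$.
   Context: Colour sets and partitions: a colour set is a set $\mathcal A$ with an involution $a\mapsto a^{-1}$. For words $w,w'$ on $\mathcal A$, an element of $P^{\mathcal A}(w,w')$ is a partition of $|w|+|w'|$ points drawn as an upper row coloured (left to right) by $w$ and a lower row coloured by $w'$; its subsets are called blocks. It is noncrossing if there are no four points $k_1<k_2<k_3<k_4$ (ordering: upper row left to right, then lower row right to left) with $k_1,k_3$ in one block and $k_2,k_4$ in a different block. Category operations: tensor product (horizontal juxtaposition), composition $qp$ (stack $q$ below $p$, erase middle points and closed loops), adjoint $p^*$ (reflection), rotation (move an extreme point of one row to the same end of the other row, replacing its colour $a$ by $a^{-1}$). A category of noncrossing partitions is a family $\mathcal C(w,w')\subset NC^{\mathcal A}(w,w')$ stable under these operations and containing $\pi(a,a)$ for all $a$. $\mathbb G_N(\mathcal C)$ is the unique compact quantum group with $N$-dimensional unitary representations $u^a$ generating $C(\mathbb G_N(\mathcal C))$ such that $\mathrm{Mor}(u^{\otimes w},u^{\otimes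 w'})$ is spanned by the maps $T_p$, $p\in\mathcal C(w,w')$, where $T_p(e_{i})=\sum_j\delta_p(i,j)e_j$ with $\delta_p(i,j)=1$ iff indices in a common block are equal. Notation: $\pi(w,w')$ is the one-block partition; $\beta(w,w')$ is the partition whose blocks are the set of all upper points and the set of all lower points. For a category $\mathcal C$ on $\{x,y\}$, $\mathcal C_x$ (resp. $\mathcal C_y$) consists of its partitions all of whose points are coloured $x$ (resp. $y$); $\mathcal C$ is a free product if it is generated by $\mathcal C_x\cup\mathcal C_y$. Free wreath products of pairs: let $\Gamma$ be a group with symmetric generating set $S$ (colour set $S$ with involution $g\mapsto g^{-1}$). $\mathcal C_{\Gamma,S}$ is the category of all $S$-coloured noncrossing partitions such that for each block the product in $\Gamma$ of the colours of its upper points (left to right) equals the product of the colours of its lower points (left to right; an empty product is $e$). For $\lambda=g_1\cdots g_n$ ($g_i\in S$) let $\beta_\lambda=\beta(g_1\cdots g_n,g_1\cdots g_n)$. For a subgroup $\Lambda\subset\Gamma$, $\mathcal C_{\Gamma,\Lambda,S}$ is the category generated by $\mathcal C_{\Gamma,S}$ and all $\beta_\lambda$, $\lambda\in\Lambda$, and $H_N^+(\Gamma,\Lambda)=\mathbb G_N(\mathcal C_{\Gamma,\Lambda,S})$. For $d\geqslant1$, $\Gamma_d$ is the quotient of $\mathbb Z_2*\mathbb Z_2=\langle x,y\mid x^2=y^2=1\rangle$ by $(xy)^d=e$, and $\Gamma_0=\mathbb Z_2*\mathbb Z_2$; the generating set is $\{x,y\}$. Every integer divides $0$. *)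

(* Defs.v *)
From mathcomp Require Import all_boot.
Set Implicit Arguments. Unset Strict Implicit. Unset Printing Implicit Defensive.

(* Colour set {x,y}, encoded by bool; the involution is trivial
   (x^{-1} = x, y^{-1} = y), so rotations keep colours unchanged. *)
Definition cx : bool := false.
Definition cy : bool := true.

(* Points: U i = i-th upper point (left to right, from 0),
           L j = j-th lower point (left to right, from 0). *)
Inductive pt := U of nat | L of nat.

(* A partition with upper colouring [up] and lower colouring [lo];
   [blk a b] means a and b lie in a common block. *)
Record part := Part { up : seq bool; lo : seq bool; blk : pt -> pt -> bool }.

Definition vld (w w' : seq bool) (a : pt) : bool :=
  match a with U i => i < size w | L j => j < size w' end.
Definition valid (p : part) (a : pt) : bool := vld (up p) (lo p) a.

Definition is_part (p : part) : Prop :=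
  [/\ (forall a b, blk p a b -> valid p a && valid p b),
      (forall a, valid p a -> blk p a a),
      (forall a b, blk p a b -> blk p b a) &
      (forall a b c, blk p a b -> blk p b c -> blk p a c)].

Definition peq (p q : part) : Prop :=
  [/\ up p = up q, lo p = lo q & forall a b, blk p a b = blk q a b].

(* position in the order: upper row left to right, then lower row right to left *)
Definition pos (p : part) (a : pt) : nat :=
  match a with U i => i | L j => size (up p) + (size (lo p) - j.+1) end.

Definition noncrossing (p : part) : Prop :=
  forall a b c d, valid p a -> valid p b -> valid p c -> valid p d ->
    pos p a < pos p b -> pos p b < pos p c -> pos p c < pos p d ->
    blk p a c -> blk p b d -> blk p a b.

Definition upblock (p : part) (a : pt) : seq nat :=
  [seq i <- iota 0 (size (up p)) | blk p (U i) a].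
Definition loblock (p : part) (a : pt) : seq nat :=
  [seq j <- iota 0 (size (lo p)) | blk p (L j) a].
Definition bsize (p : part) (a : pt) : nat := size (upblock p a) + size (loblock p a).
Definition upword (p : part) (a : pt) : seq bool := [seq nth cx (up p) i | i <- upblock p a].
Definition loword (p : part) (a : pt) : seq bool := [seq nth cx (lo p) j | j <- loblock p a].

Definition pi_part (w w' : seq bool) : part :=
  Part w w' (fun a b => vld w w' a && vld w w' b).
Definition same_row (a b : pt) : bool :=
  match a, b with U _, U _ => true | L _, L _ => true | _, _ => false end.
Definition beta_part (w w' : seq bool) : part :=
  Part w w' (fun a b => [&& vld w w' a, vld w w' b & same_row a b]).

Definition tensor (p q : part) : part :=
  let sh a := match a with U i => U (i - size (up p)) | L j => L (j - size (lo p)) end in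
  Part (up p ++ up q) (lo p ++ lo q)
    (fun a b => if valid p a && valid p b then blk p a b
                else if ~~ valid p a && ~~ valid p b then blk q (sh a) (sh b)
                else false).

Definition flip (a : pt) : pt := match a with U i => L i | L j => U j end.
Definition adjoint (p : part) : part :=
  Part (lo p) (up p) (fun a b => blk p (flip a) (flip b)).

Definition reindex (w w' : seq bool) (f : pt -> pt) (p : part) : part :=
  Part w w' (fun a b => [&& vld w w' a, vld w w' b & blk p (f a) (f b)]).

(* rotations (colour a becomes a^{-1} = a) *)
Definition rotUL (p : part) : part :=
  reindex (behead (up p)) (head cx (up p) :: lo p)
    (fun a => match a with U i => U i.+1 | L 0 => U 0 | L j.+1 => L j end) p.
Definition rotLU (p : part) : part :=
  reindex (head cx (lo p) :: up p) (behead (lo p))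
    (fun a => match a with U 0 => L 0 | U i.+1 => U i | L j => L j.+1 end) p.
Definition rotUR (p : part) : part :=
  reindex (take (size (up p)).-1 (up p)) (rcons (lo p) (last cx (up p)))
    (fun a => match a with U i => U i
              | L j => if j == size (lo p) then U (size (up p)).-1 else L j end) p.
Definition rotLR (p : part) : part :=
  reindex (rcons (up p) (last cx (lo p))) (take (size (lo p)).-1 (lo p))
    (fun a => match a with L j => L j
              | U i => if i == size (up p) then L (size (lo p)).-1 else U i end) p.

(* composition q p: q stacked below p (requires lo p = up q); middle points
   erased, blocks connected through the middle row, closed loops dropped *)
Inductive cpt := CU of nat | CM of nat | CL of nat.
Definition cE (p q : part) (u v : cpt) : bool :=
  match u, v with
  | CU i, CU j => blk p (U i) (U j)
  | CU i, CM j => blk p (U i) (L j)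
  | CM i, CU j => blk p (L i) (U j)
  | CM i, CM j => blk p (L i) (L j) || blk q (U i) (U j)
  | CM i, CL j => blk q (U i) (L j)
  | CL i, CM j => blk q (L i) (U j)
  | CL i, CL j => blk q (L i) (L j)
  | _, _ => false
  end.
Definition cpts (p q : part) : seq cpt :=
  [seq CU i | i <- iota 0 (size (up p))] ++ [seq CM j | j <- iota 0 (size (lo p))]
  ++ [seq CL k | k <- iota 0 (size (lo q))].
Fixpoint reach (E : cpt -> cpt -> bool) (s : seq cpt) (n : nat) (u v : cpt) : bool :=
  match n with
  | 0 => E u v
  | n'.+1 => reach E s n' u v || has (fun w => E u w && reach E s n' w v) s
  end.
Definition emb (a : pt) : cpt := match a with U i => CU i | L k => CL k end.
Definition comp (q p : part) : part :=
  Part (up p) (lo q)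
    (fun a b => [&& vld (up p) (lo q) a, vld (up p) (lo q) b &
                    reach (cE p q) (cpts p q) (size (cpts p q)) (emb a) (emb b)]).

Record category (C : part -> Prop) : Prop := {
  cat_nc : forall p, C p -> is_part p /\ noncrossing p;
  cat_peq : forall p q, C p -> peq p q -> C q;
  cat_id : forall c : bool, C (pi_part [:: c] [:: c]);
  cat_tensor : forall p q, C p -> C q -> C (tensor p q);
  cat_comp : forall p q, C p -> C q -> lo p = up q -> C (comp q p);
  cat_adj : forall p, C p -> C (adjoint p);
  cat_rotUL : forall p, C p -> 0 < size (up p) -> C (rotUL p);
  cat_rotLU : forall p, C p -> 0 < size (lo p) -> C (rotLU p);
  cat_rotUR : forall p, C p -> 0 < size (up p) -> C (rotUR p);
  cat_rotLR : forall p, C p -> 0 < size (lo p) -> C (rotLR p)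
}.

Inductive gen (G : part -> Prop) : part -> Prop :=
| gen_base p : G p -> gen G p
| gen_id (c : bool) : gen G (pi_part [:: c] [:: c])
| gen_peq p q : gen G p -> peq p q -> gen G q
| gen_tensor p q : gen G p -> gen G q -> gen G (tensor p q)
| gen_comp p q : gen G p -> gen G q -> lo p = up q -> gen G (comp q p)
| gen_adj p : gen G p -> gen G (adjoint p)
| gen_rotUL p : gen G p -> 0 < size (up p) -> gen G (rotUL p)
| gen_rotLU p : gen G p -> 0 < size (lo p) -> gen G (rotLU p)
| gen_rotUR p : gen G p -> 0 < size (up p) -> gen G (rotUR p)
| gen_rotLR p : gen G p -> 0 < size (lo p) -> gen G (rotLR p).

Definition monochrome (c : bool) (p : part) : bool :=
  all (pred1 c) (up p) && all (pred1 c) (lo p).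
Definition free_product (C : part -> Prop) : Prop :=
  forall p, C p <-> gen (fun q => (C q /\ monochrome cx q) \/ (C q /\ monochrome cy q)) p.

Definition xy_pow (m : nat) : seq bool := flatten (nseq m [:: cx; cy]).
Definition yx_pow (m : nat) : seq bool := flatten (nseq m [:: cy; cx]).

(* equality in Gamma_d = <x,y | x^2, y^2, (xy)^d> of the products of two words:
   the congruence on words generated by the relators (d = 0 gives Z2*Z2) *)
Inductive geq (d : nat) : seq bool -> seq bool -> Prop :=
| geq_refl w : geq d w w
| geq_sym u v : geq d u v -> geq d v u
| geq_trans u v w : geq d u v -> geq d v w -> geq d u w
| geq_ctx l r u v : geq d u v -> geq d (l ++ u ++ r) (l ++ v ++ r)
| geq_xx : geq d [:: cx; cx] [::]
| geq_yy : geq d [:: cy; cy] [::]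
| geq_rel : geq d (xy_pow d) [::].

Definition in_Lambda (d n : nat) (w : seq bool) : Prop :=
  exists k : nat, geq d w (xy_pow (n * k)) \/ geq d w (yx_pow (n * k)).

Definition C_Gamma (d : nat) (p : part) : Prop :=
  [/\ is_part p, noncrossing p &
      forall a, valid p a -> geq d (upword p a) (loword p a)].

Definition C_Gamma_Lambda (d n : nat) : part -> Prop :=
  gen (fun p => C_Gamma d p \/ exists w, in_Lambda d n w /\ p = beta_part w w).

(* Main.v *)
(* A category of noncrossing partitions is determined by its one-row members, and a
   one-row partition is a word of coloured points labelled by blocks. On such words
   the category operations amount to rotation, reflection, insertion and capping two
   adjacent points of equal colour.

   Gluing a word to its mirror image along a common part shows that a block of size
   at least four containing the colour c yields the block cccc; since C is not a free
   product, some block is bicoloured, and this gives xxxx, yyyy and xyyx in C. Hence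
   adjacent points may be merged. Then the words w whose one-block partition lies in
   C form the kernel of the projection onto some Gamma_d, and those w with beta_w in C
   form the preimage of some Lambda_n. Conversely, any member of C is rebuilt from its
   one-block and beta partitions: merge an innermost block w, which is an interval,
   into a neighbouring block, and cut it out again with beta_w. *)
Require Import Defs.
From mathcomp Require Import all_boot zify.
From Stdlib Require Import Classical.
Set Implicit Arguments. Unset Strict Implicit. Unset Printing Implicit Defensive.

Local Notation geq := Defs.geq.
Local Notation pword := (seq (bool * nat)).

(** * Encoding partitions by labelled words *)

Definition lab (s : pword) (i : nat) : nat := (nth (cx, 0) s i).2.

Definition row (s : pword) : part :=
  Part [::] (map fst s)
    (fun a b => match a, b with
                | L i, L j => [&& i < size s, j < size s & lab s i == lab s j]
                | _, _ => false end).

(* Points are read along the lower row from left to right, then along the upper row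
   from right to left: the reverse of the order [pos]. *)
Definition idx (m n : nat) (a : pt) : nat :=
  match a with L j => j | U i => m + (n - i.+1) end.

(** The labels of [s] name the blocks of [p]. Only the kernel of the labelling matters, so [s] is
    not unique. *)
Definition encodes (p : part) (s : pword) : Prop :=
  map fst s = lo p ++ rev (up p) /\
  forall a b, blk p a b =
    [&& valid p a, valid p b &
        lab s (idx (size (lo p)) (size (up p)) a)
        == lab s (idx (size (lo p)) (size (up p)) b)].

(** Common interface of a category and of a generated family [gen G], where noncrossing would depend
    on [G]. Closure lemmas proved from it serve both inclusions of the final equality. *)
Record precategory (C : part -> Prop) : Prop := {
  cl_peq : forall p q, C p -> peq p q -> C q;
  cl_id : forall c : bool, C (pi_part [:: c] [:: c]);
  cl_tensor : forall p q, C p -> C q -> C (tensor p q);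
  cl_comp : forall p q, C p -> C q -> lo p = up q -> C (Defs.comp q p);
  cl_adj : forall p, C p -> C (adjoint p);
  cl_rotLU : forall p, C p -> 0 < size (lo p) -> C (rotLU p);
  cl_rotUR : forall p, C p -> 0 < size (up p) -> C (rotUR p);
  cl_rotLR : forall p, C p -> 0 < size (lo p) -> C (rotLR p)
}.

Lemma category_precategory C : category C -> precategory C.
Proof. by case. Qed.

Lemma gen_precategory G : precategory (gen G).
Proof.
split; [exact: gen_peq | exact: gen_id | exact: gen_tensor | exact: gen_comp
  | exact: gen_adj | exact: gen_rotLU | exact: gen_rotUR | exact: gen_rotLR].
Qed.

Lemma gen_sub (C G : part -> Prop) :
  category C -> (forall p, G p -> C p) -> forall p, gen G p -> C p.
Proof.
move=> catC GC p; elim=> {p}.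
- exact: GC.
- exact: cat_id.
- by move=> p q _ Cp; apply: cat_peq.
- by move=> p q _ Cp _; apply: cat_tensor.
- by move=> p q _ Cp _; apply: cat_comp.
- by move=> p _; apply: cat_adj.
- by move=> p _; apply: cat_rotUL.
- by move=> p _; apply: cat_rotLU.
- by move=> p _; apply: cat_rotUR.
- by move=> p _; apply: cat_rotLR.
Qed.

Lemma row_encodes s : encodes (row s) s.
Proof.
split=> [|[i|i] [j|j]] //=; first by rewrite cats0.
  by rewrite /valid /= andbF.
by rewrite /valid /= size_map.
Qed.

(** The length of the upper row tells where the common colour word is to be cut into its two
    rows. *)
Lemma encodes_peq p q s : encodes p s -> encodes q s -> size (up p) = size (up q) -> peq p q.
Proof.
case: p q => [u l B] [u' l' B'] [/= ws HB] [/= ws' HB'] szu.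
have szl : size l = size l'.
  by have := congr1 size ws; have := congr1 size ws'; rewrite !size_cat !size_rev; lia.
have /eqP := etrans (esym ws) ws'; rewrite eqseq_cat // => /andP[/eqP ell /eqP eru].
have eu : u = u' by rewrite -[u]revK eru revK.
by subst; split=> //= a b; rewrite HB HB'.
Qed.

(** Used for the rotations at the right end: they move a point to the other row but keep its reading
    index, so the labelled word does not change. *)
Lemma encodes_reindex p s w w' f :
  map fst s = w' ++ rev w ->
  (forall a, vld w w' a -> valid p (f a) /\
     idx (size (lo p)) (size (up p)) (f a) = idx (size w') (size w) a) ->
  encodes p s -> encodes (Defs.reindex w w' f p) s.
Proof.
move=> ws Hf [_ HB]; split=> //= a b; rewrite /valid /=.
have [va|//] := boolP (vld w w' a); have [vb|//] := boolP (vld w w' b).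
have [vfa ea] := Hf _ va; have [vfb eb] := Hf _ vb.
by rewrite HB vfa vfb ea eb.
Qed.

Lemma encodes_rotUR p s : encodes p s -> 0 < size (up p) -> encodes (rotUR p) s.
Proof.
case: p => u l B rp /=; case/lastP: u rp => // u c rp _; rewrite /rotUR /=.
rewrite size_rcons last_rcons -cats1 take_size_cat //.
apply: encodes_reindex => //=.
  by case: rp => -> _ /=; rewrite rev_rcons cat_rcons.
case=> i /=; rewrite ?size_rcons /valid /= !size_cat /=; first by lia.
by move=> ilt; case: eqP => /=; rewrite ?size_cat /=; lia.
by rewrite cats1.
Qed.

Lemma encodes_rotLR p s : encodes p s -> 0 < size (lo p) -> encodes (rotLR p) s.
Proof.
case: p => u l B rp /=; case/lastP: l rp => // l c rp _; rewrite /rotLR /=.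
rewrite size_rcons last_rcons -[rcons l c]cats1 take_size_cat //.
apply: encodes_reindex => //=.
  by case: rp => -> _ /=; rewrite rev_rcons -cat_rcons.
case=> i /=; rewrite ?size_rcons /valid /= !size_cat /=; last by lia.
by move=> ilt; case: eqP => /=; rewrite ?size_cat /=; lia.
by rewrite cats1.
Qed.

Lemma encodes_adjoint p s : encodes p s -> encodes (adjoint p) (rev s).
Proof.
case: p => u l B [/= ws HB]; split=> /=.
  by rewrite map_rev ws rev_cat revK.
have szs : size s = size l + size u.
  by rewrite -(size_map fst) ws size_cat size_rev.
have Hx a : vld l u a -> lab (rev s) (idx (size u) (size l) a)
                       = lab s (idx (size l) (size u) (flip a)).
  by case: a => i /= ilt; rewrite /lab nth_rev ?szs; try congr (_ (nth _ _ _)); lia.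
move=> a b; rewrite /valid HB /valid /=.
have vf x : vld u l (flip x) = vld l u x by case: x.
rewrite !vf; have [va|//] := boolP (vld l u a); have [vb|//] := boolP (vld l u b).
by rewrite !Hx.
Qed.

Section Closed.
Variable C : part -> Prop.
Hypothesis clC : precategory C.

(** The upper points are rotated one by one, at the right end, into the lower row. *)
Lemma encodes_row p s : encodes p s -> C p -> C (row s).
Proof.
elim: {p}(size (up p)) {-2}p (erefl (size (up p))) => [|n IHn] p szp rp Cp.
  by apply: (cl_peq clC Cp); apply: (encodes_peq rp (row_encodes s)); rewrite szp.
have up0 : 0 < size (up p) by rewrite szp.
apply: (IHn (rotUR p)); [|exact: encodes_rotUR|exact: (cl_rotUR clC)].
by rewrite /rotUR /= size_take szp /= leqnn.
Qed.

Lemma row_of_encodes p s : encodes p s -> C (row s) -> C p.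
Proof.
move=> rp Cs.
(* Rotating back as many points as [p] has in its upper row recovers [p]. *)
have [q Cq [rq szq]] : exists2 q, C q & encodes q s /\ size (up q) = size (up p).
  have : size (up p) <= size s.
    by rewrite -(size_map fst) rp.1 size_cat size_rev leq_addl.
  elim: (size (up p)) => [_|n IHn ns]; first by exists (row s) => //;
    split=> //; exact: row_encodes.
  have [|q Cq [rq szq]] := IHn _; first by lia.
  have lo0 : 0 < size (lo q).
    by have := congr1 size rq.1; rewrite size_map size_cat size_rev; lia.
  exists (rotLR q); first exact: (cl_rotLR clC).
  by split; [exact: encodes_rotLR | rewrite /rotLR /= size_rcons szq].
by apply: (cl_peq clC Cq); apply: (encodes_peq rq rp).
Qed.

End Closed.

(** * Category operations on labelled words *)

Definition labs (s : pword) : seq nat := map snd s.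
Definition relab (f : nat -> nat) (s : pword) : pword := [seq (x.1, f x.2) | x <- s].
Definition lb (a : nat) (w : seq bool) : pword := [seq (c, a) | c <- w].
(** Merges block [b] into block [a], the effect of joining a point of each. *)
Definition upd (b a l : nat) : nat := if l == b then a else l.

Lemma relab_cat f s t : relab f (s ++ t) = relab f s ++ relab f t.
Proof. exact: map_cat. Qed.
Lemma lb_cat a u v : lb a (u ++ v) = lb a u ++ lb a v.
Proof. exact: map_cat. Qed.
Lemma relab_rev f s : relab f (rev s) = rev (relab f s).
Proof. exact: map_rev. Qed.
Lemma lb_rev a u : lb a (rev u) = rev (lb a u).
Proof. exact: map_rev. Qed.
Lemma size_relab f s : size (relab f s) = size s.
Proof. exact: size_map. Qed.
Lemma map_fst_relab f s : map fst (relab f s) = map fst s.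
Proof. by rewrite -map_comp; apply: eq_map. Qed.
Lemma map_fst_lb a w : map fst (lb a w) = w.
Proof. by rewrite -map_comp map_id. Qed.
Lemma relab_lb f a w : relab f (lb a w) = lb (f a) w.
Proof. by rewrite /relab -map_comp. Qed.
Lemma labs_cat s t : labs (s ++ t) = labs s ++ labs t.
Proof. exact: map_cat. Qed.
Lemma labs_rev s : labs (rev s) = rev (labs s).
Proof. exact: map_rev. Qed.
Lemma labs_relab f s : labs (relab f s) = map f (labs s).
Proof. by rewrite /labs /relab -!map_comp. Qed.
Lemma labs_lb a w : labs (lb a w) = nseq (size w) a.
Proof. by elim: w => //= c w ->. Qed.
Lemma mem_labs_lb a b w : b \in labs (lb a w) -> b = a.
Proof. by rewrite labs_lb mem_nseq => /andP[_ /eqP]. Qed.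

Lemma relab_id f s : {in labs s, f =1 id} -> relab f s = s.
Proof.
elim: s => //= -[c a] s IHs Hf; rewrite /= Hf ?mem_head // IHs // => b bs.
by apply: Hf; rewrite inE bs orbT.
Qed.

Lemma relab_fresh a b s : b \notin labs s -> relab (upd b a) s = s.
Proof.
move=> bs; apply: relab_id => l ls; rewrite /upd; case: eqP => // lb'.
by rewrite -lb' ls in bs.
Qed.

Lemma mem_lab s i : i < size s -> lab s i \in labs s.
Proof. by move=> ilt; rewrite /lab -(nth_map _ 0) // mem_nth ?size_map. Qed.

Lemma lab_relab f s i : i < size s -> lab (relab f s) i = f (lab s i).
Proof. by move=> ilt; rewrite /lab (nth_map (cx, 0)). Qed.

Definition strand_id (a : pt) : nat := match a with U i => i | L i => i end.
Definition idpart (w : seq bool) : part :=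
  Part w w (fun a b => [&& vld w w a, vld w w b & strand_id a == strand_id b]).

(* The partition in P(w1 c c w2, w1 w2) capping the two middle points: [0] is the
   cap and [j.+1] the through strand ending at the j-th lower point. *)
Definition strand_cap (n : nat) (a : pt) : nat :=
  match a with
  | U i => if i < n then i.+1 else if i < n.+2 then 0 else i.-1
  | L j => j.+1
  end.

Ltac split_ifs :=
  repeat match goal with
  | |- context [if ?b then _ else _] => let E := fresh "E" in case E: b
  end.
Definition cappart (w1 : seq bool) (c : bool) (w2 : seq bool) : part :=
  Part (w1 ++ c :: c :: w2) (w1 ++ w2)
    (fun a b => [&& vld (w1 ++ c :: c :: w2) (w1 ++ w2) a,
                    vld (w1 ++ c :: c :: w2) (w1 ++ w2) b &
                    strand_cap (size w1) a == strand_cap (size w1) b]).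

(** An invariant of edges is an invariant of paths; this bounds from above the blocks of a
    composition. *)
Lemma reach_sound (T : Type) (F : cpt -> T) (E : cpt -> cpt -> bool) s :
  (forall u v, E u v -> F u = F v) ->
  forall n u v, reach E s n u v -> F u = F v.
Proof.
move=> HE; elim=> [|n IHn] u v /=; first exact: HE.
case/orP=> [/IHn //|]; elim: {2}s => //= w s' IHs.
by case/orP=> [/andP[/HE -> /IHn]|/IHs].
Qed.

Lemma reach_step p q n u j v : j < size (lo p) ->
  cE p q u (CM j) -> reach (cE p q) (cpts p q) n (CM j) v ->
  reach (cE p q) (cpts p q) n.+1 u v.
Proof.
move=> jlt Euj rjv /=; apply/orP; right.
rewrite {1}/cpts !has_cat; apply/orP; right; apply/orP; left.
rewrite has_map; apply/hasP; exists j; first by rewrite mem_iota.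
by rewrite /= Euj rjv.
Qed.

Lemma reach_mono E s n m u v : n <= m -> reach E s n u v -> reach E s m u v.
Proof.
move=> nm; rewrite -(subnK nm); elim: (m - n) => //= k IHk r.
by rewrite IHk.
Qed.

Section Rows.
Variable C : part -> Prop.
Hypothesis clC : precategory C.

Lemma row_ker s t : map fst s = map fst t ->
  (forall i j, i < size s -> j < size s -> (lab s i == lab s j) = (lab t i == lab t j)) ->
  C (row s) -> C (row t).
Proof.
move=> st Hl Cs; apply: (cl_peq clC Cs); split=> //= -[i|i] [j|j] //.
have <- : size s = size t by rewrite -(size_map fst) st size_map.
by have [ilt|//] := boolP (i < size s); have [jlt|//] := boolP (j < size s); rewrite Hl.
Qed.

Lemma row_relab f s : {in labs s &, injective f} -> C (row s) -> C (row (relab f s)).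
Proof.
move=> injf; apply: row_ker => [|i j ilt jlt]; first by rewrite map_fst_relab.
by rewrite !lab_relab // (inj_in_eq injf) // mem_lab.
Qed.

Lemma row_rev s : C (row s) -> C (row (rev s)).
Proof.
move=> Cs; apply: (encodes_row clC (encodes_adjoint (row_encodes s))).
exact: (cl_adj clC).
Qed.

Lemma row_pair c a : C (row [:: (c, a); (c, a)]).
Proof.
apply: (encodes_row clC _ (cl_id clC c)); split=> //= x y; rewrite /valid /=.
case: x y => [[|i]|[|i]] [[|j]|[|j]] //=;
  rewrite ?andbF //= /lab /= eqxx //.
Qed.

Lemma row_rot1 x s : C (row (x :: s)) -> C (row (rcons s x)).
Proof.
(* The first point goes up at the left end and, being alone in the upper row, comes down at the
   right end. *)
move=> Cs; apply: (cl_peq clC (cl_rotUR clC (cl_rotLU clC Cs _) _)) => //.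
split=> /=; [by [] | by rewrite map_rcons|].
case=> [i|i] [j|j] //=; rewrite ?size_map ?size_rcons /lab ?nth_rcons ?andbF //.
have [->|ni] := eqVneq i (size s); have [->|nj] := eqVneq j (size s);
  rewrite /= ?ltnn ?leqnn ?eqxx ?size_map ?ltnSn ?ltnS ?leqnn /= ?(negPf ni) ?(negPf nj) //.
- by rewrite (leq_eqVlt j) (negPf nj) /=; case: ltnP.
- by rewrite (leq_eqVlt i) (negPf ni) /=; case: ltnP.
- rewrite (leq_eqVlt i) (leq_eqVlt j) (negPf ni) (negPf nj) /=.
  by case: (ltnP i) => ?; case: (ltnP j).
Qed.

Lemma row_rot s t : C (row (s ++ t)) -> C (row (t ++ s)).
Proof.
elim: s t => [|x s IHs] t; first by rewrite cats0.
by rewrite cat_cons => /row_rot1; rewrite -cats1 -catA => /IHs; rewrite -catA.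
Qed.

Lemma row_cat s t : (forall a, a \in labs s -> a \notin labs t) ->
  C (row s) -> C (row t) -> C (row (s ++ t)).
Proof.
move=> dj Cs Ct; apply: (cl_peq clC (cl_tensor clC Cs Ct)).
split=> //=; first by rewrite map_cat.
case=> [i|i] [j|j] //=; rewrite /valid /= ?size_map ?andbF ?if_same //.
have lab_cat k : lab (s ++ t) k = if k < size s then lab s k else lab t (k - size s).
  by rewrite /lab nth_cat; case: ifP.
rewrite size_cat !lab_cat.
have [ilt|ige] := ltnP i (size s); have [jlt|jge] := ltnP j (size s) => /=.
- by rewrite (ltn_addr _ ilt) (ltn_addr _ jlt).
- rewrite (ltn_addr _ ilt) /=; apply/esym/negbTE; apply/negP => /andP[jlt /eqP eij].
  have := dj _ (mem_lab ilt); rewrite eij mem_lab //; lia.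
- rewrite (ltn_addr _ jlt) /=; apply/esym/negbTE; apply/negP => /andP[ilt /eqP eij].
  have := dj _ (mem_lab jlt); rewrite -eij mem_lab //; lia.
- by congr [&& _, _ & _]; lia.
Qed.

(** A rotation moves the insertion gap to the end, where insertion is a tensor product. *)
Lemma row_ins s1 t s2 : (forall a, a \in labs t -> a \notin labs (s1 ++ s2)) ->
  C (row (s1 ++ s2)) -> C (row t) -> C (row (s1 ++ t ++ s2)).
Proof.
move=> dj /row_rot C21 Ct; rewrite catA; apply: row_rot; rewrite catA.
apply: row_cat => // a; apply: contraL => /dj.
by rewrite !labs_cat !mem_cat orbC.
Qed.

Lemma row_nil : C (row [::]).
Proof.
(* A pair composed with its adjoint is a single closed loop, which is erased. *)
apply: (cl_peq clC (cl_comp clC (row_pair cx 0) (cl_adj clC (row_pair cx 0)) _)) => //.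
by split=> //= -[i|i] [j|j].
Qed.

Lemma C_idpart w : C (idpart w).
Proof.
elim: w => [|c w IHw].
  by apply: (cl_peq clC row_nil); split=> //= -[i|i] [j|j].
apply: (cl_peq clC (cl_tensor clC (cl_id clC c) IHw)).
split=> //= -[[|i]|[|i]] [[|j]|[|j]] //=; rewrite /valid /= ?andbT ?subn1 //=; lia.
Qed.

Lemma C_cappart w1 c w2 : C (cappart w1 c w2).
Proof.
have Ccap : C (adjoint (row [:: (c, 0); (c, 0)])) by apply: (cl_adj clC); apply: row_pair.
apply: (cl_peq clC (cl_tensor clC (C_idpart w1) (cl_tensor clC Ccap (C_idpart w2)))).
split=> //= -[i|i] [j|j]; rewrite /valid /= ?size_cat /=.
- have lab0 k : lab [:: (c, 0); (c, 0)] k = 0 by case: k => [|[|k]] //; rewrite /lab nth_default.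
  by rewrite !lab0; split_ifs; lia.
- by split_ifs; lia.
- by split_ifs; lia.
- by split_ifs; lia.
Qed.

(** Composition with [cappart] erases the two points and joins their blocks. *)
Lemma row_cap s1 c a b s2 : C (row (s1 ++ (c, a) :: (c, b) :: s2)) ->
  C (row (relab (upd b a) (s1 ++ s2))).
Proof.
set s := s1 ++ _; set w1 := map fst s1; set w2 := map fst s2 => Cs.
have ws : map fst s = w1 ++ c :: c :: w2 by rewrite map_cat.
have w1E : size w1 = size s1 by rewrite size_map.
apply: (cl_peq clC (cl_comp clC Cs (C_cappart w1 c w2) _)) => //.
split=> //=; first by rewrite map_fst_relab map_cat.
have szs : size s = (size s1 + size s2).+2 by rewrite size_cat /=; lia.
case=> [i|i] [j|j] //=; first by rewrite andbF.
have -> : size (w1 ++ w2) = size (s1 ++ s2) by rewrite !size_cat !size_map.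
rewrite size_relab.
have [ilt|//] := boolP (i < _); have [jlt|//] := boolP (j < _).
rewrite !andTb !lab_relab //.
(* [src k] is the position in [s] of the [k]-th surviving point. *)
pose src k := if k < size s1 then k else k.+2.
have src_lt k : k < size (s1 ++ s2) -> src k < size s.
  by rewrite size_cat szs /src; split_ifs; lia.
have lab_src k : lab s (src k) = lab (s1 ++ s2) k.
  rewrite /lab /src /s; have [klt|kge] := ltnP k (size s1); rewrite !nth_cat ?klt //.
  rewrite !ltnNge kge (leq_trans kge) /=; last by lia.
  by rewrite (_ : k.+2 - size s1 = (k - size s1).+2) //; lia.
have lab1 : lab s (size s1) = a by rewrite /lab nth_cat ltnn subnn.
have lab2 : lab s (size s1).+1 = b by rewrite /lab nth_cat ltnNge leqnSn /= subSnn.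
have szq : size (w1 ++ c :: c :: w2) = size s by rewrite -ws size_map.
have szlo : size (w1 ++ w2) = size (s1 ++ s2) by rewrite !size_cat !size_map.
apply/idP/eqP.
  (* The merged label [F] is constant along edges: on those of the cap because it factors through
     the strand, to which [G] gives its label. *)
  pose F x := match x with CM k => upd b a (lab s k)
    | CL k => upd b a (lab (s1 ++ s2) k) | CU _ => 0 end.
  pose G x := if x is 0 then a else upd b a (lab (s1 ++ s2) x.-1).
  have qlab x : vld (w1 ++ c :: c :: w2) (w1 ++ w2) x ->
     G (strand_cap (size w1) x) =
     match x with U k => upd b a (lab s k) | L k => upd b a (lab (s1 ++ s2) k) end.
    case: x => k //=; rewrite szq w1E => klt.
    have [k1|k1] := ltnP k (size s1).
      by rewrite /= -lab_src /src k1.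
    have [k2|k2] /= := ltnP k (size s1).+2.
      have [->|->] : k = size s1 \/ k = (size s1).+1 by lia.
        by rewrite lab1 /upd; case: eqP.
      by rewrite lab2 /upd eqxx.
    case: k klt k1 k2 => [|[|k]] // klt k1 k2 /=.
    by rewrite -lab_src /src; split_ifs => //; lia.
  have qF x y : blk (cappart w1 c w2) x y ->
    match x with U k => upd b a (lab s k) | L k => upd b a (lab (s1 ++ s2) k) end =
    match y with U k => upd b a (lab s k) | L k => upd b a (lab (s1 ++ s2) k) end.
    by case/and3P=> vx vy /eqP exy; rewrite -!qlab // exy.
  apply: (reach_sound (F := F)) => -[u|u|u] [v|v|v] //=.
  - by case/orP=> [/and3P[_ _ /eqP ->] //|/(qF (U u) (U v))].
  - exact: (qF (U u) (L v)).
  - exact: (qF (L u) (U v)).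
  - exact: (qF (L u) (L v)).
move=> eqF.
have Edown k : k < size (s1 ++ s2) -> cE (row s) (cappart w1 c w2) (CM (src k)) (CL k)
             /\ cE (row s) (cappart w1 c w2) (CL k) (CM (src k)).
  move=> klt; have := src_lt _ klt; rewrite /= szq szlo klt w1E => -> /=.
  by rewrite /src; case: (ltnP k (size s1)) => [->|kge] //;
     split; split_ifs; lia.
have Erow k l : k < size s -> l < size s -> lab s k = lab s l ->
    cE (row s) (cappart w1 c w2) (CM k) (CM l).
  by move=> klt llt ekl; rewrite /= klt llt ekl eqxx.
have Ecap k l : size s1 <= k < (size s1).+2 -> size s1 <= l < (size s1).+2 ->
    cE (row s) (cappart w1 c w2) (CM k) (CM l).
  move=> kk ll; apply/orP; right; rewrite /= szq w1E szs.
  by split_ifs; lia.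
have szlt k : k < size s -> k < size (lo (row s)) by rewrite /= size_map.
(* Conversely, points with equal merged labels either share a label already or have labels [a] and
   [b]; in the latter case the path crosses the cap from [k1] to [k2]. *)
have [k1 [k2 [k1lt k2lt e1 e2 e12]]] : exists k1 k2, [/\ k1 < size s, k2 < size s,
    lab s (src i) = lab s k1, lab s k2 = lab s (src j) &
    cE (row s) (cappart w1 c w2) (CM k1) (CM k2)].
  have [eij|nij] := eqVneq (lab s (src i)) (lab s (src j)).
    exists (src i), (src j); rewrite !src_lt //; split=> //.
    by apply: Erow; rewrite ?src_lt.
  have cap_pt l : l = a \/ l = b -> exists2 k, size s1 <= k < (size s1).+2 & lab s k = l.
    by case=> ->; [exists (size s1) | exists (size s1).+1] => //; lia.
  have [|k1 k1P e1] := cap_pt (lab s (src i)).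
    move: eqF nij; rewrite -!lab_src /upd.
    by case: (eqVneq _ b) => [|_]; [right|case: eqP => [_ ->|_ -> /eqP]; [left|]].
  have [|k2 k2P e2] := cap_pt (lab s (src j)).
    move: eqF nij; rewrite -!lab_src /upd.
    by case: (eqVneq _ b) => [_|_]; case: eqP => [->|_ <- /eqP //]; [right|left|right].
  exists k1, k2; split; rewrite ?e1 ?e2 //; [lia|lia|exact: Ecap].
(* The path has five edges, hence four intermediate points. A surviving point forces at least three
   middle points and one lower point, so the bound built into [comp] is large enough. *)
apply: (@reach_mono _ _ 4).
  by move: ilt; rewrite /cpts !(size_cat, size_map, size_iota) /= ?size_cat ?size_map /=; lia.
apply: (reach_step (szlt _ (src_lt _ ilt)) (Edown _ ilt).2).
apply: (reach_step (szlt _ k1lt)); first by apply: Erow; rewrite ?src_lt.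
apply: (reach_step (szlt _ k2lt)) => //.
apply: (reach_step (szlt _ (src_lt _ jlt))); first by apply: Erow; rewrite ?src_lt.
exact: (Edown _ jlt).1.
Qed.

End Rows.

(** * Noncrossing labelled words, their blocks and innermost intervals *)

Definition nc (s : pword) : Prop :=
  forall a b, a != b -> ~~ subseq [:: a; b; a; b] (labs s).

Definition word (s : pword) (l : nat) : seq bool := [seq x.1 | x <- s & x.2 == l].

Definition ptof (p : part) (i : nat) : pt :=
  if i < size (lo p) then L i else U (size (up p) - (i - size (lo p)).+1).

Definition pidx (p : part) (a : pt) : nat := idx (size (lo p)) (size (up p)) a.

Lemma ptofP p i : i < size (lo p) + size (up p) -> valid p (ptof p i) /\ pidx p (ptof p i) = i.
Proof. by move=> ilt; rewrite /ptof /valid /pidx; case: ltnP => ige /=; lia. Qed.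

Lemma ptof_pidx p a : valid p a -> ptof p (pidx p a) = a.
Proof.
rewrite /valid /ptof /pidx; case: a => i /= ilt; last by rewrite ilt.
by case: ltnP => ige; [lia | congr U; lia].
Qed.

Lemma pidx_lt p a : valid p a -> pidx p a < size (lo p) + size (up p).
Proof. by rewrite /valid /pidx; case: a => i /=; lia. Qed.

Lemma pos_pidx p a : valid p a -> pos p a + pidx p a = (size (lo p) + size (up p)).-1.
Proof. by rewrite /valid /pidx; case: a => i /=; lia. Qed.

Lemma encodes_size p s : encodes p s -> size s = size (lo p) + size (up p).
Proof. by case=> ws _; rewrite -(size_map fst) ws size_cat size_rev. Qed.

Lemma lab_nth s i : lab s i = nth 0 (labs s) i.
Proof.
rewrite /lab /labs; have [ilt|ige] := ltnP i (size s); first by rewrite (nth_map (cx, 0)).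
by rewrite !nth_default ?size_map.
Qed.

Lemma subseq_split (a : nat) r t : subseq (a :: r) t ->
  exists t1 t2, t = t1 ++ a :: t2 /\ subseq r t2.
Proof.
elim: t => //= x t IHt; case: eqP => [->|_] sub; first by exists [::], t.
by have [t1 [t2 [-> sub2]]] := IHt sub; exists (x :: t1), t2.
Qed.

Lemma encodes_nc p s : encodes p s -> noncrossing p -> nc s.
Proof.
move=> rp ncp a b nab; apply/negP.
case/subseq_split=> t1 [r1 [es /subseq_split [t2 [r2 [er1]]]]].
case/subseq_split=> t3 [r3 [er2 /subseq_split [t4 [r4 [er3 _]]]]]; subst.
pose i1 := size t1; pose i2 := i1 + (size t2).+1; pose i3 := i2 + (size t3).+1.
pose i4 := i3 + (size t4).+1.
have szs : size s = (i4 + size r4).+1.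
  rewrite -(size_map snd) -/(labs s) es /i4 /i3 /i2 /i1.
  by rewrite size_cat /= size_cat /= size_cat /= size_cat /=; lia.
have skip (t : seq nat) x r k : nth 0 (t ++ x :: r) (size t + k) = nth 0 (x :: r) k.
  by rewrite nth_cat ltnNge leq_addr /= addKn.
have l1 : lab s i1 = a by rewrite lab_nth es /i1 -(addn0 (size t1)) skip.
have l2 : lab s i2 = b.
  by rewrite lab_nth es /i2 /i1 skip /= -(addn0 (size t2)) skip.
have l3 : lab s i3 = a.
  by rewrite lab_nth es /i3 /i2 /i1 -addnA skip /= skip /= -(addn0 (size t3)) skip.
have l4 : lab s i4 = b.
  by rewrite lab_nth es /i4 /i3 /i2 /i1 -!addnA skip /= skip /= skip /= -(addn0 (size t4)) skip.
have rsz := encodes_size rp; have i12 : i1 < i2 by rewrite /i2; lia.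
have i23 : i2 < i3 by rewrite /i3; lia.
have i34 : i3 < i4 by rewrite /i4; lia.
have blkE i j : i < size s -> j < size s -> blk p (ptof p i) (ptof p j) = (lab s i == lab s j).
  move=> ilt jlt; rewrite rp.2 -!/(pidx p _).
  have [|-> ->] := @ptofP p i; first by rewrite -rsz.
  by have [|-> ->] := @ptofP p j; first by rewrite -rsz.
have posE i : i < size s -> pos p (ptof p i) = (size s).-1 - i.
  move=> ilt; have [|v e] := @ptofP p i; first by rewrite -rsz.
  by have := pos_pidx v; rewrite e rsz; lia.
have vE i : i < size s -> valid p (ptof p i).
  by move=> ilt; have [|v e] := @ptofP p i; first by rewrite -rsz.
(* The four points are taken in decreasing reading index because [pos] runs the opposite way. *)
have := ncp (ptof p i4) (ptof p i3) (ptof p i2) (ptof p i1).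
rewrite !vE ?posE ?blkE; lia.
Qed.

Lemma word_nth t w l : map fst t = w ->
  word t l = [seq nth cx w j | j <- iota 0 (size w) & lab t j == l].
Proof.
move=> <-; rewrite size_map /word.
rewrite -{1}(mkseq_nth (cx, 0) t) /mkseq filter_map -map_comp; apply/eq_in_map => j.
rewrite mem_filter mem_iota /= => /andP[_ jlt].
by rewrite (nth_map (cx, 0)).
Qed.

Lemma word_cat s t l : word (s ++ t) l = word s l ++ word t l.
Proof. by rewrite /word filter_cat map_cat. Qed.

Lemma word_rev s l : word (rev s) l = rev (word s l).
Proof. by rewrite /word filter_rev map_rev. Qed.

Lemma size_word s l : size (word s l) = count (pred1 l) (labs s).
Proof. by rewrite /word size_map size_filter /labs count_map. Qed.

(** The upper row is read backwards, and reversal inverts products of involutions. Thus the block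
    condition of [C_Gamma] says that this word is trivial in the group. *)
Lemma encodes_word p s a : encodes p s -> valid p a ->
  word s (lab s (pidx p a)) = loword p a ++ rev (upword p a).
Proof.
move=> rp va; have szs := encodes_size rp.
set l := lab _ _.
pose m := size (lo p); pose t := take m s; pose t' := rev (drop m s).
have est : s = t ++ rev t' by rewrite revK cat_take_drop.
have wt : map fst t = lo p by rewrite map_take rp.1 take_size_cat.
have wt' : map fst t' = up p by rewrite map_rev map_drop rp.1 drop_size_cat ?revK.
have szt : size t = m by rewrite -(size_map fst) wt.
have szt' : size t' = size (up p) by rewrite -(size_map fst) wt'.
rewrite est word_cat word_rev (word_nth _ wt) (word_nth _ wt').
have e1 : [seq j <- iota 0 (size (lo p)) | lab t j == l] = loblock p a.
  apply: eq_in_filter => j; rewrite mem_iota /= add0n => jlt.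
  by rewrite rp.2 va /valid /= jlt /= -/(pidx p a) -/l [lab s j]/lab est nth_cat szt jlt.
have e2 : [seq j <- iota 0 (size (up p)) | lab t' j == l] = upblock p a.
  apply: eq_in_filter => j; rewrite mem_iota /= add0n => jlt.
  rewrite rp.2 va /valid /= jlt /= -/(pidx p a) -/l [lab s _]/lab est nth_cat szt.
  rewrite ltnNge leq_addr /= addKn nth_rev szt'; last by lia.
  by congr (_ == _); congr (_ (nth _ _ _)); lia.
by rewrite e1 e2.
Qed.

Lemma encodes_bsize p s a : encodes p s -> valid p a ->
  bsize p a = count (pred1 (lab s (pidx p a))) (labs s).
Proof.
move=> rp va; rewrite -size_word (encodes_word rp va) size_cat size_rev.
by rewrite /bsize /loword /upword !size_map addnC.
Qed.

Lemma mem_labsP s l : l \in labs s -> exists2 i, i < size s & lab s i = l.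
Proof.
move=> ls; exists (index l (labs s)); first by rewrite -(size_map snd) index_mem.
by rewrite lab_nth nth_index.
Qed.

Lemma encodes_pt p s l : encodes p s -> l \in labs s -> exists2 a, valid p a & lab s (pidx p a) = l.
Proof.
move=> rp /mem_labsP[i ilt <-]; have [|v e] := @ptofP p i; first by rewrite -(encodes_size rp).
by exists (ptof p i); rewrite ?e.
Qed.

Lemma encodes_exists p : is_part p -> exists s, encodes p s.
Proof.
case=> vB rB sB tB; pose N := size (lo p) + size (up p).
(* A block is named by the reading index of its first point. *)
pose lbl i := find (fun k => blk p (ptof p k) (ptof p i)) (iota 0 N).
exists [seq (nth cx (lo p ++ rev (up p)) i, lbl i) | i <- iota 0 N].
have wN : size (lo p ++ rev (up p)) = N by rewrite size_cat size_rev.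
split; first by rewrite -map_comp -[RHS](mkseq_nth cx) wN.
move=> a b; have [va|nva] := boolP (valid p a); last first.
  by apply/negbTE; apply: contraNN nva => /vB/andP[].
have [vb|nvb] := boolP (valid p b); last first.
  by apply/negbTE; apply: contraNN nvb => /vB/andP[].
rewrite -!/(pidx p _) /lab !(nth_map 0) ?size_iota ?pidx_lt //= !nth_iota ?pidx_lt //.
rewrite !add0n /lbl !ptof_pidx //; apply/idP/eqP => [ab|].
  apply: eq_find => k; apply/idP/idP => [ka|kb]; first exact: tB ka ab.
  exact: tB kb (sB _ _ ab).
set f := fun k => blk _ _ a; set g := fun k => blk _ _ b => fg.
have hf : has f (iota 0 N).
  apply/hasP; exists (pidx p a); first by rewrite mem_iota add0n pidx_lt.
  by rewrite /f ptof_pidx // rB.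
have hg : has g (iota 0 N).
  apply/hasP; exists (pidx p b); first by rewrite mem_iota add0n pidx_lt.
  by rewrite /g ptof_pidx // rB.
have := nth_find 0 hf; rewrite fg => h1; have := nth_find 0 hg => h2.
exact: tB (sB _ _ h1) h2.
Qed.

Lemma fresh_label s : exists K, {in labs s, forall a, a < K}.
Proof.
elim: s => [|[c a] s [K HK]]; first by exists 0.
exists (maxn K a.+1) => b; rewrite leq_max inE => /orP[/eqP ->|/HK ->] //=; rewrite leqnn orbT //.
Qed.

(** By induction the tail has a block [b] that is an interval. Only if the first point belongs to
    [b] can this fail for the whole word; then either the interval extends to the left, or the gap
    before it contains another interval block. *)
Lemma nc_interval s : nc s -> s <> [::] ->
  exists s1 w s2 a, [/\ s = s1 ++ lb a w ++ s2, w <> [::] & a \notin labs (s1 ++ s2)].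
Proof.
have [n] := ubnP (size s); elim: n s => // n IHn [//|[c a] s] sn ncs _.
have ncs' t : subseq t ((c, a) :: s) -> nc t.
  move=> ts x y nxy; apply: contra (ncs x y nxy) => /subseq_trans; apply.
  exact: map_subseq.
have [->|s0] := eqVneq s [::]; first by exists [::], [:: c], [::], a.
have [||s1 [w [s2 [b [es w0 bn]]]]] := IHn s _ _ (elimN eqP s0); first by [].
  by apply: ncs'; apply: subseq_cons.
have [ab|nab] := eqVneq a b; last first.
  exists ((c, a) :: s1), w, s2, b; split=> //; first by rewrite es.
  by rewrite /= inE negb_or eq_sym nab.
case: s1 es bn => [|x s1] es bn.
  by exists [::], (c :: w), s2, a; rewrite es ab.
have [|||u1 [w' [u2 [b' [eu w'0 b'n]]]]] := IHn (x :: s1) => //.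
- by move: sn; rewrite es /= !size_cat /=; lia.
- apply: ncs'; rewrite es; apply: subseq_trans (subseq_cons _ _).
  exact: prefix_subseq.
have b's1 : b' \in labs (x :: s1).
  rewrite eu !labs_cat !mem_cat labs_lb mem_nseq eqxx andbT.
  by case: (w') w'0 => //= *; rewrite orbT.
have nb'b : b' != b.
  by apply: contraNneq bn => <-; rewrite labs_cat mem_cat b's1.
exists ((c, a) :: u1), w', (u2 ++ lb b w ++ s2), b'; split=> //.
  by rewrite es eu /= -!catA.
rewrite /= inE ab negb_or nb'b /= !labs_cat !mem_cat !negb_or.
move: b'n; rewrite labs_cat mem_cat negb_or => /andP[-> ->] /=.
rewrite labs_lb mem_nseq negb_and nb'b orbT /=.
(* If [b'] occurred again after the interval of [b], the first point would start a crossing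
   [b b' b b']. *)
apply/negP => b's2; have := ncs b b'; rewrite eq_sym nb'b => /(_ isT)/negP; apply.
rewrite /= ab eqxx es labs_cat -[_ :: _]/([:: b'] ++ ([:: b] ++ [:: b'])).
apply: cat_subseq; first by rewrite sub1seq.
rewrite labs_cat; apply: cat_subseq; rewrite sub1seq // labs_lb mem_nseq eqxx andbT.
by case: (w) w0.
Qed.

(** * Capping, doubling and merging *)

Section RowOps.
Variable C : part -> Prop.
Hypothesis clC : precategory C.

Lemma row_cap' s1 c a b s2 : C (row (s1 ++ (c, a) :: (c, b) :: s2)) ->
  C (row (relab (upd a b) (s1 ++ s2))).
Proof.
move/(row_rev clC); rewrite rev_cat !rev_cons !cat_rcons => /(row_cap clC).
by rewrite -rev_cat relab_rev => /(row_rev clC); rewrite revK.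
Qed.

Lemma row_cap_same s1 c a s2 :
  C (row (s1 ++ (c, a) :: (c, a) :: s2)) -> C (row (s1 ++ s2)).
Proof.
move/(row_cap clC); rewrite relab_id // => l _.
by rewrite /upd; case: eqP.
Qed.

Lemma row_cap_word s1 t s2 : C (row (s1 ++ t ++ rev t ++ s2)) -> C (row (s1 ++ s2)).
Proof.
elim/last_ind: t s2 => [//|t [c a] IHt] s2; rewrite rev_rcons cat_rcons /= catA.
by move/row_cap_same; rewrite -catA => /IHt.
Qed.

Lemma row_lb a b w : C (row (lb a w)) -> C (row (lb b w)).
Proof.
move=> Ca; rewrite -(relab_lb (fun _ => b) a); apply: row_relab Ca => //.
by move=> x y /mem_labs_lb -> /mem_labs_lb ->.
Qed.

Lemma row_lb2 a b a' b' u v : a != b -> a' != b' ->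
  C (row (lb a u ++ lb b v)) -> C (row (lb a' u ++ lb b' v)).
Proof.
move=> ab a'b' Cab; pose f x := if x == a then a' else b'.
have fa : f a = a' by rewrite /f eqxx.
have fb : f b = b' by rewrite /f eq_sym (negPf ab).
rewrite -fa -fb -!relab_lb -relab_cat; apply: row_relab Cab => // x y.
rewrite labs_cat !mem_cat => /orP[]/mem_labs_lb -> /orP[]/mem_labs_lb -> //;
  by rewrite fa fb => /eqP; rewrite ?(negPf a'b') // eq_sym (negPf a'b').
Qed.

(* Composing with its own mirror image glues a block of [u] to its reflection as
   soon as the block reaches [v]. *)
Lemma row_double u v K : {in labs (u ++ v), forall a, a < K} ->
  C (row (u ++ v)) ->
  C (row (u ++ rev (relab (fun l => if l \in labs v then l else l + K) u))).
Proof.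
move=> HK Cuv.
(* [S] holds the labels already glued to their mirror images; the other mirror labels are made fresh
   by the shift [K]. Each cap between the last letter of [v] and its reflection adds a label to
   [S]. *)
pose g (S : seq nat) l := if l \in S then l else l + K.
suff main S : C (row (u ++ v ++ rev (relab (g S) v) ++ rev (relab (g S) u))) ->
    C (row (u ++ rev (relab (g (S ++ labs v)) u))).
  apply: (main [::]); rewrite catA -rev_cat -relab_cat; apply: (row_cat clC) => //.
    move=> a /HK aK; rewrite labs_rev mem_rev labs_relab; apply/negP.
    by case/mapP=> x _; rewrite /g /=; lia.
  by apply: row_rev => //; apply: row_relab Cuv => // x y _ _; rewrite /g /=; lia.
elim/last_ind: v S {Cuv} HK => [|v [c l] IHv] S HK; first by rewrite cats0.
have HKuv : {in labs (u ++ v), forall a, a < K}.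
  move=> a; rewrite labs_cat => auv; apply: HK; rewrite -cats1 !labs_cat !mem_cat.
  by move: auv; rewrite mem_cat => /orP[] -> //; rewrite orbT.
have lK : l < K by apply: HK; rewrite -cats1 !labs_cat !mem_cat mem_head !orbT.
rewrite /relab map_rcons rev_rcons -/(relab _ _) cat_rcons /= catA => /(row_cap clC).
have gS t : {subset labs t <= labs (u ++ v)} ->
    relab (upd (g S l) l) (relab (g S) t) = relab (g (l :: S)) t.
  move=> tuv; rewrite /relab -map_comp; apply/eq_in_map => -[d x] xt /=; congr (_, _).
  have xK : x < K by apply/HKuv/tuv/mapP; exists (d, x).
  rewrite /upd /g inE; case: (x =P l) => [->|xl] /=; first by rewrite eqxx.
  by case: (x \in S); case: (l \in S); case: eqP => //; lia.
rewrite !relab_cat [relab _ u]relab_id; last first.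
  move=> x xu; have xK : x < K by apply: HKuv; rewrite labs_cat mem_cat xu.
  by rewrite /upd /g; case: (l \in S); case: eqP => //; lia.
rewrite [relab _ v]relab_id; last first.
  move=> x xv; have xK : x < K by apply: HKuv; rewrite labs_cat mem_cat xv orbT.
  by rewrite /upd /g; case: (l \in S); case: eqP => //; lia.
rewrite !relab_rev !gS; try by move=> x; rewrite labs_cat mem_cat => ->; rewrite ?orbT.
rewrite -catA => /IHv - /(_ HKuv); congr (C (row (u ++ rev _))).
apply: eq_map => -[d x] /=; congr (_, _); rewrite /g; congr (if _ then _ else _).
by rewrite -cats1 labs_cat !mem_cat !inE /= mem_cat orbC orbA.
Qed.

Lemma row_double_in b w v : b \in labs v ->
  C (row (lb b w ++ v)) -> C (row (lb b (w ++ rev w))).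
Proof.
move=> bv Cv; have [K HK] := fresh_label (lb b w ++ v).
by have := row_double HK Cv; rewrite relab_lb bv lb_cat lb_rev.
Qed.

(** The block stays within the doubled part, so it is never glued to its reflection, and the result
    is [beta_w] written as a row. *)
Lemma row_double_notin b w v : b \notin labs v ->
  C (row (lb b w ++ v)) -> C (row (lb 0 w ++ lb 1 (rev w))).
Proof.
move=> bv Cv; have [K HK] := fresh_label (lb b w ++ v).
have := row_double HK Cv; rewrite relab_lb (negPf bv).
have [->|w0] := eqVneq w [::]; first by [].
rewrite -lb_rev => Cbb; apply: row_lb2 Cbb => //.
suff : b < K by lia.
by apply: HK; rewrite labs_cat labs_lb mem_cat mem_nseq eqxx andbT; case: (w) w0.
Qed.

(* Merging two adjacent points is composition with the four-block pi(c c', c c'). *)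
Lemma row_merge c c' s1 a b s2 : C (row (lb 0 [:: c'; c; c; c'])) ->
  C (row (s1 ++ (c, a) :: (c', b) :: s2)) ->
  C (row (relab (upd b a) (s1 ++ (c, a) :: (c', b) :: s2))).
Proof.
move=> C4 Cs; have [K HK] := fresh_label (s1 ++ (c, a) :: (c', b) :: s2).
have Kn : K \notin labs (s1 ++ (c, a) :: (c', b) :: s2).
  by apply/negP => /HK; rewrite ltnn.
move: Kn; rewrite labs_cat mem_cat /= !inE !negb_or.
case/and4P=> Ks1 Ka Kb Ks2.
(* The four-block is inserted behind the two points. Capping [c'] with [c'] and then [c] with [c]
   consumes both points and leaves copies of them in one block. *)
have : C (row ((s1 ++ [:: (c, a); (c', b)]) ++ lb K [:: c'; c; c; c'] ++ s2)).
  apply: (row_ins clC); [|by rewrite -catA|exact: row_lb C4].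
  by move=> x /mem_labs_lb ->; rewrite !labs_cat !mem_cat /= !inE !negb_or Ks1 Ka Kb.
rewrite -catA /= -cat_rcons => /(row_cap clC).
rewrite cat_rcons relab_cat (relab_fresh _ Ks1) /=.
rewrite /upd eqxx -!/(upd _ _) eq_sym (negPf Ka).
rewrite (relab_fresh _ Ks2) => /(row_cap clC).
by rewrite !relab_cat /= /upd eqxx; case: eqP.
Qed.

Lemma row_merge' c c' s1 a b s2 : C (row (lb 0 [:: c; c'; c'; c])) ->
  C (row (s1 ++ (c, a) :: (c', b) :: s2)) ->
  C (row (relab (upd a b) (s1 ++ (c, a) :: (c', b) :: s2))).
Proof.
move=> C4 /(row_rev clC); rewrite rev_cat !rev_cons !cat_rcons => /(row_merge C4).
rewrite (_ : rev s2 ++ _ = rev (s1 ++ (c, a) :: (c', b) :: s2)).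
  by rewrite relab_rev => /(row_rev clC); rewrite revK.
by rewrite rev_cat !rev_cons !cat_rcons.
Qed.

End RowOps.

(** * Words in the dihedral groups *)

Lemma xy_powD a b : xy_pow (a + b) = xy_pow a ++ xy_pow b.
Proof. by rewrite /xy_pow nseqD flatten_cat. Qed.

Lemma rev_xy_pow k : rev (xy_pow k) = yx_pow k.
Proof.
by elim: k => // k IHk; rewrite -{1}addn1 xy_powD rev_cat IHk.
Qed.

Lemma geq_cons d c u v : geq d u v -> geq d (c :: u) (c :: v).
Proof. by move=> uv; have := geq_ctx [:: c] [::] uv; rewrite !cats0. Qed.

Lemma geq_catl d w u v : geq d u v -> geq d (w ++ u) (w ++ v).
Proof. by move=> uv; elim: w => //= c w; apply: geq_cons. Qed.

Lemma geq_cc d c u : geq d (c :: c :: u) u.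
Proof.
have H : geq d [:: c; c] [::] by case: c; [exact: geq_yy | exact: geq_xx].
exact: (geq_ctx [::] u H).
Qed.

Lemma geq_revK d u : geq d (rev u ++ u) [::].
Proof.
elim: u => [|c u IHu]; first exact: geq_refl.
rewrite rev_cons cat_rcons; apply: geq_trans IHu.
exact/geq_catl/geq_cc.
Qed.

(** Words of even length represent elements of the cyclic group generated by [xy]; the powers of
    [yx] are its negative powers. *)
Lemma geq_normal d w : ~~ odd (size w) ->
  exists k, geq d w (xy_pow k) \/ geq d w (yx_pow k).
Proof.
have [n] := ubnP (size w); elim: n w => // n IHn [|c [|c' w]] //= sw.
  by move=> _; exists 0; left; exact: geq_refl.
rewrite negbK => ow; have [|k Hk] := IHn w _ ow; first by lia.
have [ecc'|ncc'] := eqVneq c c'.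
  exists k; rewrite -ecc'; case: Hk => Hk; [left|right]; exact: geq_trans (geq_cc _ _ _) Hk.
have step v : geq d w v -> geq d [:: c, c' & w] [:: c, c' & v].
  by move=> H; apply/geq_cons/geq_cons.
have cancel v : geq d [:: c, c', c', c & v] v.
  exact: geq_trans (geq_cons _ (geq_cc _ _ _)) (geq_cc _ _ _).
case: c c' ncc' step cancel => [] [] // _ step cancel; case: Hk => Hk.
- case: k Hk => [|k] Hk; first by exists 1; right; apply: step.
  by exists k; left; apply: geq_trans (step _ Hk) (cancel _).
- by exists k.+1; right; apply: step.
- by exists k.+1; left; apply: step.
- case: k Hk => [|k] Hk; first by exists 1; left; apply: step.
  by exists k; right; apply: geq_trans (step _ Hk) (cancel _).
Qed.

Lemma geq_xy_mul d q : geq d (xy_pow (d * q)) [::].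
Proof.
elim: q => [|q IHq]; first by rewrite muln0; exact: geq_refl.
rewrite mulnS xy_powD; apply: geq_trans IHq.
exact: (geq_ctx [::] _ (geq_rel d)).
Qed.

Lemma geq_yx_mul d q : geq d (yx_pow (d * q)) [::].
Proof.
apply: geq_trans (geq_revK d (xy_pow (d * q))); rewrite rev_xy_pow.
rewrite -{1}[yx_pow _]cats0; apply/geq_catl/geq_sym/geq_xy_mul.
Qed.

(** The nonnegative part of a subgroup of the integers: [m] is its least positive element, or 0 if
    there is none. *)
Lemma dvd_of_subgroup (Q : nat -> Prop) :
  Q 0 -> (forall a b, Q a -> Q b -> Q (a + b)) -> (forall a b, Q (a + b) -> Q b -> Q a) ->
  exists m, forall k, Q k <-> m %| k.
Proof.
move=> Q0 QD QB.
have Qmul m q : Q m -> Q (m * q).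
  by move=> Qm; elim: q => [|q IHq]; rewrite ?muln0 // mulnS; apply: QD.
have [[k [k0 Qk]]|nQ] := classic (exists k, 0 < k /\ Q k); last first.
  exists 0 => k; rewrite dvd0n; split=> [Qk|/eqP -> //].
  by apply/negPn/negP => k0; apply: nQ; exists k; rewrite lt0n.
have [m [m0 Qm mmin]] : exists m, [/\ 0 < m, Q m & forall j, 0 < j -> Q j -> m <= j].
  have [n] := ubnP k; elim: n k k0 Qk => // n IHn k k0 Qk kn.
  have [[j [j0 Qj jk]]|nj] := classic (exists j, [/\ 0 < j, Q j & j < k]).
    by apply: (IHn j) => //; lia.
  exists k; split=> // j j0 Qj; rewrite leqNgt; apply/negP => jk; apply: nj.
  by exists j.
exists m => j; split=> [Qj|/dvdnP[q ->]]; last by rewrite mulnC; apply: Qmul.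
have Qr : Q (j %% m).
  by apply: (QB _ (m * (j %/ m))); [rewrite addnC mulnC -divn_eq | exact: Qmul].
rewrite /dvdn; apply/negPn/negP; rewrite -lt0n => r0.
by have := mmin _ r0 Qr; rewrite leqNgt ltn_pmod.
Qed.

(** * Sets of words closed under the group operations *)

Section WordSets.
Variable P : seq bool -> Prop.
Hypothesis P0 : P [::].
Hypothesis Pcat : forall u v, P u -> P v -> P (u ++ v).
Hypothesis Pdel : forall u c v, P (u ++ c :: c :: v) -> P (u ++ v).
Hypothesis Prev : forall u, P u -> P (rev u).

Lemma word_del u v w : P (u ++ v ++ rev v ++ w) -> P (u ++ w).
Proof.
elim/last_ind: v w => [//|v c IHv] w; rewrite rev_rcons cat_rcons /= catA.
by move/Pdel; rewrite -catA => /IHv.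
Qed.

(** Exponents can be subtracted because appending a reversed power cancels. This produces [d] from
    the one-block words and [n] from the beta words. *)
Lemma xy_pow_subgroup : exists m, forall k, P (xy_pow k) <-> m %| k.
Proof.
apply: dvd_of_subgroup => // a b.
  by move=> Pa Pb; rewrite xy_powD; apply: Pcat.
move=> Pab Pb; have := Pcat Pab (Prev Pb); rewrite xy_powD -catA -[X in _ ++ X]cats0.
by rewrite -catA => /word_del; rewrite cats0.
Qed.

Hypothesis Pins : forall u c v, P (u ++ v) -> P (u ++ c :: c :: v).
Hypothesis Prot : forall u v, P (u ++ v) -> P (v ++ u).

Lemma geq_word d : P (xy_pow d) -> forall u v, geq d u v ->
  forall l r, P (l ++ u ++ r) <-> P (l ++ v ++ r).
Proof.
move=> Pd u v; elim=> {u v}.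
- by [].
- by move=> u v _ IH l r; split=> /IH.
- by move=> u v w _ IH1 _ IH2 l r; split=> [/IH1/IH2|/IH2/IH1].
- by move=> l' r' u v _ IH l r; rewrite -!catA !(catA l); exact: IH.
- by move=> l r; split=> [/Pdel|]; last exact: Pins.
- by move=> l r; split=> [/Pdel|]; last exact: Pins.
(* The relator is rotated to the front, where it is cancelled by its reverse or added by
   concatenation. *)
move=> l r; split=> [/Prot|/Prot]; rewrite -?catA => H.
  have := Pcat (Prev Pd) H; rewrite -{2}[xy_pow d]revK => /(@word_del [::]).
  by move=> H2; apply: (@Prot r l).
by apply: Prot; rewrite -catA; apply: Pcat => //; rewrite cat0s in H.
Qed.

Lemma word_rev_ins u : P (u ++ rev u).
Proof.
elim/last_ind: u => // u c; rewrite rev_rcons cat_rcons; exact: Pins.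
Qed.

End WordSets.

(** * One-block and two-block partitions *)

Lemma constant_or_change (w : seq bool) :
  (exists c, w = nseq (size w) c) \/ exists w1 c w2, w = w1 ++ c :: ~~ c :: w2.
Proof.
elim: w => [|c w [[c' ->]|[w1 [c' [w2 ->]]]]]; first by left; exists cx.
  case: (size w) => [|n]; first by left; exists c.
  have [->|ncc'] := eqVneq c c'; first by left; exists c'; rewrite /= size_nseq.
  by right; exists [::], c, (nseq n c'); case: c c' ncc' => [] [].
by right; exists (c :: w1), c', w2.
Qed.

Lemma upd_fix b a : upd b a a = a.
Proof. by rewrite /upd if_same. Qed.

Lemma upd_at b a : upd b a b = a.
Proof. by rewrite /upd eqxx. Qed.

Lemma mem_lb a w x : (x \in lb a w) = (x.2 == a) && (x.1 \in w).
Proof.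
case: x => c l /=; apply/mapP/andP => [[c' c'w [-> ->]]|[/eqP -> cw]]; first by rewrite eqxx.
by exists c.
Qed.

Lemma mem_labs x s : x \in s -> x.2 \in labs s.
Proof. by move=> xs; apply/mapP; exists x. Qed.

Lemma row_is_part s : is_part (row s).
Proof.
split.
- by case=> [i|i] [j|j] //=; rewrite /valid /= size_map => /and3P[-> ->].
- by case=> [i|i] //=; rewrite /valid /= size_map => ->; rewrite eqxx.
- by case=> [i|i] [j|j] //= /and3P[-> -> /eqP ->]; rewrite eqxx.
- by case=> [i|i] [j|j] [k|k] //= /and3P[-> _ /eqP ->] /and3P[_ -> ->].
Qed.

Lemma split_two_labels b s : 1 < count (pred1 b) (labs s) ->
  exists s1 c s2, s = s1 ++ (c, b) :: s2 /\ b \in labs s2.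
Proof.
elim: s => //= -[c l] s IHs /=; have [->|_] := eqVneq l b.
  by rewrite add1n ltnS -has_count has_pred1 => bs; exists [::], c, s.
by rewrite add0n => /IHs[s1 [c' [s2 [-> bs2]]]]; exists ((c, l) :: s1), c', s2.
Qed.

Section Blocks.
Variable C : part -> Prop.
Hypothesis clC : precategory C.

Lemma row_rot_mem x s : C (row s) -> x \in s ->
  exists2 r, C (row (x :: r)) & perm_eq s (x :: r).
Proof.
move=> Cs xs; case/splitPr: xs Cs => s1 s2 /(row_rot clC) Cr.
by exists (s2 ++ s1) => //; rewrite perm_catC.
Qed.

Lemma row_cap_nseq s1 a n c s2 : ~~ odd n ->
  C (row (s1 ++ lb a (nseq n c) ++ s2)) -> C (row (s1 ++ s2)).
Proof.
move=> on; rewrite -(odd_double_half n) (negPf on) add0n.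
elim: n./2 => //= k IHk => /(row_cap_same clC); exact: IHk.
Qed.

(* Doubling twice: first [c1 .. c2 | c2 .. c1], then [c1 c1 | c1 c1]. *)
Lemma four_block c b s : C (row ((c, b) :: s)) -> 1 < count (pred1 b) (labs s) ->
  C (row (lb 0 (nseq 4 c))).
Proof.
move=> Cs /split_two_labels[v1 [c2 [v2 [es bv2]]]].
have [K HK] := fresh_label (((c, b) :: rcons v1 (c2, b)) ++ v2).
have Cs' : C (row (((c, b) :: rcons v1 (c2, b)) ++ v2)) by rewrite /= cat_rcons -es.
have := row_double clC HK Cs'.
(* The reflected copy ends in [(c, b)]; a rotation brings it next to the original [(c, b)], and the
   pair can be doubled. *)
rewrite [relab _ (_ :: _)]/= bv2 rev_cons -[rcons (rev _) _]cats1 catA => /(row_rot clC).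
move=> Cr; apply: (row_lb clC (a := b)).
apply: (@row_double_in _ clC b [:: c; c]); last exact: Cr.
by rewrite -cats1 !labs_cat !mem_cat mem_head !orbT.
Qed.

Lemma four_block_mem c b s : C (row s) -> (c, b) \in s -> 2 < count (pred1 b) (labs s) ->
  C (row (lb 0 (nseq 4 c))).
Proof.
move=> Cs cs b3; have [r Cr prm] := row_rot_mem Cs cs.
apply: (four_block Cr); move: b3; by rewrite /labs (seq.permP (perm_map snd prm)) /= eqxx.
Qed.

(** Capping [cccc] onto the point [(c, b)] replaces it by three points of colour [c]. The block then
    has at least four points, one of them of colour [c']. *)
Lemma four_block_other c c' b s : C (row (lb 0 (nseq 4 c))) -> C (row s) ->
  (c, b) \in s -> (c', b) \in s -> C (row (lb 0 (nseq 4 c'))).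
Proof.
move=> C4 Cs cs c's; have [<- //|ncc'] := eqVneq c c'.
have [v Cv prm] := row_rot_mem Cs cs.
have c'v : (c', b) \in v.
  move: c's; rewrite (perm_mem prm) inE => /orP[/eqP[ecc']|//].
  by rewrite ecc' eqxx in ncc'.
have [K HK] := fresh_label ((c, b) :: v).
have Kn : K \notin labs ((c, b) :: v) by apply/negP => /HK; rewrite ltnn.
have C7 : C (row (lb K (nseq 3 c) ++ (c, K) :: (c, b) :: v)).
  rewrite -cat_rcons; apply: (row_cat clC) => //.
    by move=> l; rewrite -cats1 -(lb_cat K (nseq 3 c) [:: c]) => /mem_labs_lb ->.
  exact: row_lb C4.
have Cr := row_cap clC C7; apply: (four_block_mem (b := K) Cr).
  rewrite relab_cat mem_cat; apply/orP; right; apply/mapP; exists (c', b) => //=.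
  by rewrite /upd eqxx.
rewrite relab_cat labs_cat count_cat relab_lb labs_lb count_nseq /= /upd.
have -> : (K == b) = false by apply: contraNF Kn => /eqP ->; rewrite mem_head.
by rewrite eqxx.
Qed.

Hypothesis C4 : forall c c', C (row (lb 0 [:: c; c'; c'; c])).

(** A block growing from the left absorbs the points one after another. *)
Lemma row_merge_all s : C (row s) -> C (row (lb 0 (map fst s))).
Proof.
suff main n a w t : size t = n -> C (row (lb a w ++ t)) -> C (row (lb 0 (w ++ map fst t))).
  exact: (main _ 0 [::]).
elim: n a w t => [|n IHn] a w [|[c b] t] //=.
  by move=> _; rewrite !cats0; exact: row_lb.
case=> szt; case/lastP: w => [|w c0].
  exact: (IHn b [:: c] t szt).
rewrite -cats1 lb_cat -catA => /(row_merge clC (C4 _ _)).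
rewrite !relab_cat /= relab_lb !upd_fix upd_at => Cm.
have := IHn a (w ++ [:: c0; c]) (relab (upd b a) t).
rewrite size_relab map_fst_relab lb_cat -!catA => /(_ szt); apply.
exact: Cm.
Qed.

(** [D] will be the kernel of the projection onto the dihedral group and [E] the preimage of its
    subgroup. *)
Let D w := C (row (lb 0 w)).
Let E w := C (row (lb 0 w ++ lb 1 (rev w))).

Lemma one_block_cat u v : D u -> D v -> D (u ++ v).
Proof.
move=> Du Dv; have : C (row (lb 0 u ++ lb 1 v)).
  apply: (row_cat clC) => //; last exact: row_lb Dv.
  by move=> a /mem_labs_lb ->; rewrite labs_lb mem_nseq andbF.
by move/row_merge_all; rewrite map_cat !map_fst_lb.
Qed.

Lemma one_block_ins u c v : D (u ++ v) -> D (u ++ c :: c :: v).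
Proof.
move=> Duv; have : C (row (lb 0 u ++ lb 1 [:: c; c] ++ lb 0 v)).
  apply: (row_ins clC); [|by rewrite -lb_cat|exact: row_pair].
  by move=> a /mem_labs_lb ->; rewrite -lb_cat labs_lb mem_nseq andbF.
by move/row_merge_all; rewrite !map_cat !map_fst_lb.
Qed.

Lemma one_block_del u c v : D (u ++ c :: c :: v) -> D (u ++ v).
Proof. by rewrite /D !lb_cat => /(row_cap_same clC). Qed.

Lemma one_block_rot u v : D (u ++ v) -> D (v ++ u).
Proof. by rewrite /D !lb_cat => /(row_rot clC). Qed.

Lemma one_block_rev u : D u -> D (rev u).
Proof. by rewrite /D lb_rev => /(row_rev clC). Qed.

Lemma two_block_of_one w : D w -> E w.
Proof.
move=> Dw; apply: (row_cat clC) => //.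
  by move=> a /mem_labs_lb ->; rewrite labs_lb mem_nseq andbF.
by apply: row_lb (one_block_rev Dw).
Qed.

(** Nest the row of [beta_v] in the middle of that of [beta_u], then merge blocks across the two
    outer junctions. *)
Lemma two_block_cat u v : E u -> E v -> E (u ++ v).
Proof.
case/lastP: u => [//|u c]; case: v => [|c' v]; first by rewrite cats0.
move=> Eu Ev; have : C (row (lb 0 (rcons u c) ++ (lb 2 (c' :: v) ++ lb 3 (rev (c' :: v)))
     ++ lb 1 (rev (rcons u c)))).
  apply: (row_ins clC) => //; last exact: row_lb2 Ev.
  move=> a; rewrite !labs_cat !mem_cat => /orP[]/mem_labs_lb ->;
    by rewrite !labs_lb !mem_nseq !andbF.
rewrite -{1}cats1 lb_cat -!catA /= => /(row_merge clC (C4 _ _)).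
rewrite !relab_cat /= !relab_cat !relab_lb /upd /= rev_cons -cats1 lb_cat -!catA.
rewrite rev_rcons /= => Cm.
have := Cm; rewrite -[(c, 0) :: _]cat1s -[(c', 0) :: _]cat1s !catA.
move/(row_merge' clC (C4 _ _)).
rewrite !relab_cat /= !relab_lb /upd /=.
by rewrite /E rev_cat rev_rcons rev_cons -!cats1 !lb_cat -!catA.
Qed.

Lemma two_block_del u c v : E (u ++ c :: c :: v) -> E (u ++ v).
Proof.
rewrite /E !rev_cat !rev_cons !cat_rcons !lb_cat /= -!catA /= => /(row_cap_same clC).
by rewrite !catA => /(row_cap_same clC); rewrite -!catA.
Qed.

Lemma two_block_rev u : E u -> E (rev u).
Proof. by rewrite /E revK => /(row_rot clC); apply: row_lb2. Qed.

End Blocks.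

(** * Rebuilding a labelled word from its blocks *)

Lemma word_interval s1 a w s2 : a \notin labs (s1 ++ s2) -> word (s1 ++ lb a w ++ s2) a = w.
Proof.
have word_nil s : a \notin labs s -> word s a = [::].
  move=> an; apply/eqP; rewrite -size_eq0 size_word; apply/eqP/count_memPn.
  exact: an.
rewrite labs_cat mem_cat negb_or => /andP[a1 a2].
rewrite !word_cat (word_nil s1) // (word_nil s2) // cats0 cat0s.
by elim: w => //= c w; rewrite /word /= eqxx /= => ->.
Qed.

Lemma word_interval_neq s1 a w s2 l : l != a ->
  word (s1 ++ lb a w ++ s2) l = word (s1 ++ s2) l.
Proof.
move=> la; rewrite !word_cat (_ : word (lb a w) l = [::]) //.
by elim: w => //= c w; rewrite /word /= eq_sym (negPf la).
Qed.

(** An interval block is removed, the rest is built by induction, and the block is inserted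
    again. *)
Lemma row_of_blocks C s : precategory C -> nc s ->
  (forall l, l \in labs s -> C (row (lb 0 (word s l)))) -> C (row s).
Proof.
move=> clC; have [n] := ubnP (size s); elim: n s => // n IHn s sn ncs Hl.
have [->|/eqP s0] := eqVneq s [::]; first exact: row_nil.
have [s1 [w [s2 [a [es w0 an]]]]] := nc_interval ncs s0.
rewrite es; apply: (row_ins clC).
- by move=> x /mem_labs_lb ->.
- apply: IHn.
  + by move: sn; rewrite es !size_cat size_map; case: (w) w0 => //= *; lia.
  + move=> x y nxy; apply: contra (ncs x y nxy) => /subseq_trans; apply.
    rewrite es !labs_cat; apply: cat_subseq => //; exact: suffix_subseq.
  + move=> l ls; rewrite -(word_interval_neq s1 w s2 (a := a)) -?es.
      apply: Hl; move: ls; rewrite es !labs_cat !mem_cat => /orP[] ->; by rewrite ?orbT.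
    by apply: contraNneq an => <-.
- apply: (row_lb clC (a := 0)); rewrite -{1}(word_interval w an) -es; apply: Hl.
  rewrite es !labs_cat !mem_cat labs_lb mem_nseq eqxx andbT.
  by case: (w) w0 => //= *; rewrite orbT.
Qed.

(* [beta_w] cuts the interval [w] out of its block. *)
Lemma row_cut C a b w r : precategory C -> a != b -> a \notin labs r ->
  C (row (lb 0 w ++ lb 1 (rev w))) -> C (row (lb b w ++ r)) -> C (row (lb a w ++ r)).
Proof.
move=> clC ab ar Cb Cr; case: w Cb Cr => // c w Cb Cr.
have [K HK] := fresh_label ((c, a) :: lb b (c :: w) ++ r).
have Kn : K \notin labs ((c, a) :: lb b (c :: w) ++ r) by apply/negP => /HK; rewrite ltnn.
have Ka : K != a by apply: contraNneq Kn => ->; rewrite mem_head.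
have Kr : K \notin labs (lb b (c :: w) ++ r) by move: Kn; rewrite /= inE negb_or => /andP[].
(* The first cap merges [K] into [b]; the remaining letters of the reversed copy cancel those of the
   old one, leaving the copy labelled [a]. *)
have : C (row ((lb a (c :: w) ++ lb K (rev (c :: w))) ++ lb b (c :: w) ++ r)).
  apply: (row_cat clC) => //; last by apply: row_lb2 Cb => //; rewrite eq_sym.
  move=> x; rewrite labs_cat mem_cat => /orP[]/mem_labs_lb -> //.
  by rewrite labs_cat mem_cat labs_lb mem_nseq (negPf ab) andbF.
rewrite rev_cons -cats1 lb_cat -!catA /= -cat_cons catA => /(row_cap' clC).
move: Kr; rewrite labs_cat mem_cat negb_or => /andP[Kw Kr].
have upda : upd K b a = a by rewrite /upd eq_sym (negPf Ka).
rewrite !relab_cat !relab_lb upd_at upd_fix (relab_fresh _ Kr) /= relab_lb upda -catA.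
rewrite -[X in lb b X ++ r]revK (lb_rev b (rev w)) => Cw.
exact: (row_cap_word clC (s1 := lb a (c :: w)) (t := lb b (rev w))).
Qed.

Lemma row_sub_generated (C C' : part -> Prop) : category C -> precategory C' ->
  (forall c c', C (row (lb 0 [:: c; c'; c'; c]))) ->
  (forall w, C (row (lb 0 w)) -> C' (row (lb 0 w))) ->
  (forall w, C (row (lb 0 w ++ lb 1 (rev w))) -> C' (row (lb 0 w ++ lb 1 (rev w)))) ->
  forall s, C (row s) -> C' (row s).
Proof.
move=> catC clC' C4 H1 H2; have clC := category_precategory catC => s.
(* The induction is on the number of blocks, since merging keeps the number of points. *)
have [n] := ubnP (size (undup (labs s))); elim: n s => // n IHn s sn Cs.
have [->|/eqP s0] := eqVneq s [::]; first exact: row_nil.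
have ncs := encodes_nc (row_encodes s) (cat_nc catC Cs).2.
have [s1 [w [s2 [a [es w0 an]]]]] := nc_interval ncs s0.
rewrite es; apply: (row_rot clC'); rewrite -catA.
have Cr : C (row (lb a w ++ s2 ++ s1)) by rewrite catA; apply: (row_rot clC); rewrite -es.
have ar : a \notin labs (s2 ++ s1) by move: an; rewrite !labs_cat !mem_cat orbC.
have prm : perm_eq s (lb a w ++ s2 ++ s1) by rewrite es (catA _ s2) perm_catC.
move: (s2 ++ s1) Cr ar prm => r {es an} Cr ar prm.
case: r Cr ar prm => [|[c b] r] Cr ar prm.
  rewrite cats0 in Cr *; apply: (row_lb clC' (a := 0)); apply: H1.
  exact: row_lb Cr.
have nab : a != b by move: ar; rewrite /= inE negb_or => /andP[].
apply: (row_cut (b := b)) => //.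
  by apply: H2; apply: row_double_notin Cr.
apply: IHn.
  rewrite ltnS in sn; apply: leq_trans sn.
  (* After the merge the label [a] is gone and no label is new, so there is one block fewer. *)
  have sub : {subset a :: undup (labs (lb b w ++ (c, b) :: r)) <= undup (labs s)}.
    move=> x; rewrite inE !mem_undup (perm_mem (perm_map snd prm)) -/(labs _) !labs_cat.
    rewrite !mem_cat => /orP[/eqP ->|/orP[/mem_labs_lb ->|->]]; last by rewrite orbT.
      by rewrite labs_lb mem_nseq eqxx andbT; case: (w) w0.
    by rewrite /= mem_head orbT.
  apply: (uniq_leq_size _ sub); rewrite /= undup_uniq andbT mem_undup labs_cat mem_cat.
  by rewrite negb_or ar andbT labs_lb mem_nseq (negPf nab) andbF.
case/lastP: w w0 Cr {prm} => // w c0 _; rewrite -cats1 lb_cat -catA.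
move/(row_merge' clC (C4 _ _)); rewrite !relab_cat /= relab_lb upd_at upd_fix.
rewrite relab_fresh; last by move: ar; rewrite /= inE negb_or => /andP[].
by rewrite lb_cat -catA.
Qed.

(** * Categories with blocks of even size *)

Section Category.
Variable C : part -> Prop.
Hypothesis catC : category C.
Hypothesis evenC : forall p a, C p -> valid p a -> ~~ odd (bsize p a).

Let clC := category_precategory catC.

Lemma row_nc s : C (row s) -> nc s.
Proof. by move=> Cs; apply: (encodes_nc (row_encodes s)); case: (cat_nc catC Cs). Qed.

Lemma row_even s l : C (row s) -> ~~ odd (count (pred1 l) (labs s)).
Proof.
move=> Cs; have [ls|/count_memPn -> //] := boolP (l \in labs s).
have [a va <-] := encodes_pt (row_encodes s) ls.
by rewrite -(encodes_bsize (row_encodes s) va); apply: evenC.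
Qed.

Lemma interval_even s1 a w s2 : a \notin labs (s1 ++ s2) ->
  C (row (s1 ++ lb a w ++ s2)) -> ~~ odd (size w).
Proof. by move=> an /(row_even a); rewrite -size_word word_interval. Qed.

Lemma one_block_even w : C (row (lb 0 w)) -> ~~ odd (size w).
Proof. by move=> Cw; apply: (@interval_even [::] 0 w [::]); rewrite ?cats0. Qed.

Lemma two_block_even w : C (row (lb 0 w ++ lb 1 (rev w))) -> ~~ odd (size w).
Proof.
apply: (@interval_even [::]); rewrite labs_lb mem_nseq andbF //.
Qed.

(** Without bicoloured blocks an interval block is constant of even size, so caps erase it. Erasing
    all the other blocks shows that each interval block lies in [C] by itself, and insertions
    rebuild the word. *)
Lemma free_product_of_monochrome :
  (forall s b, C (row s) -> ~ ((cx, b) \in s /\ (cy, b) \in s)) -> free_product C.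
Proof.
move=> mono p; set G := fun q => _; split; last first.
  by apply: gen_sub => // q [] [].
move=> Cp; have [s rp] := encodes_exists (cat_nc catC Cp).1.
apply: (row_of_encodes (gen_precategory G) rp); have := encodes_row clC rp Cp.
move: s {p Cp rp}.
have const s1 a w s2 : C (row (s1 ++ lb a w ++ s2)) -> exists c, w = nseq (size w) c.
  move=> Cs; have [//|[w1 [c [w2 ew]]]] := constant_or_change w.
  case: (mono _ a Cs); rewrite !mem_cat !mem_lb eqxx ew !mem_cat !inE /=.
  by case: (c); rewrite !eqxx !orbT.
have erase s1 a w s2 : a \notin labs (s1 ++ s2) ->
    C (row (s1 ++ lb a w ++ s2)) -> C (row (s1 ++ s2)).
  move=> an Cs; have [c ew] := const _ _ _ _ Cs; have ow := interval_even an Cs.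
  by move: Cs; rewrite ew; apply: row_cap_nseq.
have isolate a w r : a \notin labs r -> C (row (lb a w ++ r)) -> C (row (lb a w)).
  have [n] := ubnP (size r); elim: n r => // n IHn r rn ar Cr.
  have [r0|/eqP r0] := eqVneq r [::]; first by rewrite r0 cats0 in Cr.
  have ncr : nc r.
    move=> x y nxy; apply: contra (row_nc Cr nxy) => /subseq_trans; apply.
    rewrite labs_cat; exact: suffix_subseq.
  have [r1 [w' [r2 [a' [er w'0 a'n]]]]] := nc_interval ncr r0.
  have a'r : a' \in labs r.
    rewrite er !labs_cat !mem_cat labs_lb mem_nseq eqxx andbT.
    by case: (w') w'0 => //= *; rewrite orbT.
  have aa' : a != a' by apply: contraNneq ar => ->.
  apply: (IHn (r1 ++ r2)).
  - by move: rn; rewrite er !size_cat size_map; case: (w') w'0 => //= *; lia.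
  - apply: contra ar; rewrite er !labs_cat !mem_cat => /orP[] ->; by rewrite ?orbT.
  rewrite catA; apply: (erase _ a' w'); last by rewrite -catA -er.
  rewrite -catA labs_cat mem_cat negb_or a'n andbT labs_lb mem_nseq negb_and.
  by rewrite eq_sym aa' orbT.
move=> s; have [n] := ubnP (size s); elim: n s => // n IHn s sn Cs.
have [->|/eqP s0] := eqVneq s [::]; first exact: row_nil (gen_precategory G).
have [s1 [w [s2 [a [es w0 an]]]]] := nc_interval (row_nc Cs) s0.
rewrite es in Cs *; apply: (row_ins (gen_precategory G)).
- by move=> x /mem_labs_lb ->.
- apply: IHn; last exact: erase Cs.
  by move: sn; rewrite es !size_cat size_map; case: (w) w0 => //= *; lia.
apply: gen_base; have Cw : C (row (lb a w)).
  apply: (isolate _ _ (s2 ++ s1)); first by move: an; rewrite !labs_cat !mem_cat orbC.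
  by rewrite catA; apply: (row_rot clC).
have [c ew] := const _ _ _ _ Cs.
have mono_w c' : c = c' -> monochrome c' (row (lb a w)).
  by move=> <-; rewrite /monochrome /= map_fst_lb ew all_nseq /= eqxx orbT.
by case: (c) mono_w => mono_w; [right|left]; split=> //; apply: mono_w.
Qed.

(** Constant interval blocks are erased while the bicoloured block survives, until an interval block
    has a colour change; doubling at that change gives the four-block. *)
Lemma mixed_block s b : (forall c, C (row (lb 0 (nseq 4 c)))) ->
  C (row s) -> (cx, b) \in s -> (cy, b) \in s ->
  forall c c', C (row (lb 0 [:: c; c'; c'; c])).
Proof.
move=> C4 Cs xs ys.
suff [c Cc] : exists c, C (row (lb 0 [:: c; ~~ c; ~~ c; c])).
  have Cn : C (row (lb 0 [:: ~~ c; c; c; ~~ c])).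
    by apply: (@row_rot _ clC (lb 0 [:: c; ~~ c]) (lb 0 [:: ~~ c; c])).
  by move: Cc Cn; case: c => Cc Cn [] [] //; apply: C4.
have [n] := ubnP (size s); elim: n s Cs xs ys => // n IHn s Cs xs ys sn.
have s0 : s <> [::] by move=> es; rewrite es in xs.
have [s1 [w [s2 [a [es w0 an]]]]] := nc_interval (row_nc Cs) s0.
have [[c ew]|[w1 [c [w2 ew]]]] := constant_or_change w.
  have Cs' : C (row (s1 ++ s2)).
    apply: (row_cap_nseq clC (a := a) (c := c) (n := size w)); last by rewrite -ew -es.
    by apply: (interval_even an); rewrite -es.
  have ba : b != a.
    apply/eqP => eba; move: xs ys; rewrite es eba !mem_cat !mem_lb ew !mem_nseq.
    have na x : ((x, a) \in s1) = false /\ ((x, a) \in s2) = false.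
      split; apply: contraNF an => /mem_labs /=; rewrite labs_cat mem_cat => ->;
      by rewrite ?orbT.
    by case: (na cx) => -> ->; case: (na cy) => -> ->; case: (c); rewrite /= !(andbF, orbF).
  have keep x : (x, b) \in s -> (x, b) \in s1 ++ s2.
    by rewrite es !mem_cat mem_lb /= (negPf ba).
  apply: (IHn (s1 ++ s2)) => //; try exact: keep.
  by move: sn; rewrite es !size_cat size_map; case: (w) w0 => //= *; lia.
exists c; move: Cs; rewrite es ew !lb_cat -catA.
rewrite -[lb a (c :: _)]/(lb a [:: c; ~~ c] ++ lb a w2) -!catA catA => /(row_rot clC).
rewrite -!catA; move: (lb a w2 ++ _) => v Cv.
have [av|anv] := boolP (a \in labs v).
  by apply: (row_lb clC (a := a)); exact: (row_double_in clC av Cv).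
have /= := row_double_notin clC anv Cv.
(* Here doubling gives two separate pairs; their inner points have the same colour, so the
   monochrome four-block merges them. *)
move/(row_merge clC (s1 := [:: _]) (C4 (~~ c))) => /=.
by rewrite /upd.
Qed.

End Category.

(** * Identification with the dihedral categories *)

Lemma beta_encodes w : encodes (beta_part w w) (lb 0 w ++ lb 1 (rev w)).
Proof.
split=> [|a b]; first by rewrite map_cat !map_fst_lb.
have labE x : vld w w x ->
    lab (lb 0 w ++ lb 1 (rev w)) (idx (size w) (size w) x) = if x is U _ then 1 else 0.
  rewrite lab_nth labs_cat !labs_lb size_rev nth_cat size_nseq !nth_nseq.
  by case: x => i /=; split_ifs; lia.
rewrite /valid /=; have [va|//] := boolP (vld w w a); have [vb|//] := boolP (vld w w b).
by rewrite !labE //; case: (a); case: (b).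
Qed.

Lemma one_block_C_Gamma d w : geq d w [::] -> C_Gamma d (row (lb 0 w)).
Proof.
move=> gw; have labE i : lab (lb 0 w) i = 0 by rewrite lab_nth labs_lb nth_nseq if_same.
split; first exact: row_is_part.
  by case=> [i|i] [j|j] [k|k] [l|l] //=; rewrite /valid /= !size_map // !labE => -> ->.
move=> a va; have := encodes_word (row_encodes (lb 0 w)) va.
rewrite /upword /upblock /= cats0 labE => <-.
rewrite (_ : word _ _ = w); first exact: geq_sym.
by rewrite -{2}(@word_interval [::] 0 w [::]) // cats0.
Qed.

Theorem theorem6p6 (N : nat) (C : part -> Prop) :
  4 <= N ->
  category C ->
  ~ C (pi_part [:: cx] [:: cy]) ->
  ~ free_product C ->
  (forall p a, C p -> valid p a -> ~~ odd (bsize p a)) ->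
  (exists p a, [/\ C p, valid p a & 4 <= bsize p a]) ->
  exists d n : nat, n %| d /\ (forall p, C p <-> C_Gamma_Lambda d n p).
Proof.
move=> _ catC _ nfree evenC [p [a [Cp va b4]]].
have clC := category_precategory catC.
have [t [b [Ct xt yt]]] : exists t b, [/\ C (row t), (cx, b) \in t & (cy, b) \in t].
  apply: NNPP => nmix; apply: nfree; apply: free_product_of_monochrome => // s b Cs [xs ys].
  by apply: nmix; exists s, b.
(* The large block gives [c0 c0 c0 c0] for some colour [c0]; the bicoloured block of [t] carries
   this to every colour. *)
have C4 c : C (row (lb 0 (nseq 4 c))).
  have [s rp] := encodes_exists (cat_nc catC Cp).1; have Cs := encodes_row clC rp Cp.
  rewrite (encodes_bsize rp va) in b4; set l := lab s _ in b4.
  have ls : l \in labs s by rewrite -has_pred1 has_count; lia.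
  have [[c0 l0] cs /= el] := mapP ls; rewrite -el in cs.
  have C40 := four_block_mem clC Cs cs (ltnW b4).
  by apply: (four_block_other clC C40 Ct (b := b)); [case: (c0) | case: (c)].
have M := mixed_block catC evenC C4 Ct xt yt.
pose D w := C (row (lb 0 w)); pose E w := C (row (lb 0 w ++ lb 1 (rev w))).
have D0 : D [::] by exact: row_nil.
have Dcat u v : D u -> D v -> D (u ++ v) by exact: one_block_cat.
have Ddel u c v : D (u ++ c :: c :: v) -> D (u ++ v) by exact: one_block_del.
have Dins u c v : D (u ++ v) -> D (u ++ c :: c :: v) by exact: one_block_ins.
have Drev u : D u -> D (rev u) by exact: one_block_rev.
have Drot u v : D (u ++ v) -> D (v ++ u) by exact: one_block_rot.
have DE w : D w -> E w by exact: two_block_of_one.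
have Ecat u v : E u -> E v -> E (u ++ v) by exact: two_block_cat.
have Edel u c v : E (u ++ c :: c :: v) -> E (u ++ v) by exact: two_block_del.
have Erev u : E u -> E (rev u) by exact: two_block_rev.
have [d dP] := xy_pow_subgroup D0 Dcat Ddel Drev.
have [n nP] := xy_pow_subgroup (DE _ D0) Ecat Edel Erev.
have Dd : D (xy_pow d) by apply/dP.
have geqD := geq_word Dcat Ddel Drev Dins Drot Dd.
(* The word [u ++ rev u] is in [D], and [D] is invariant under the congruence. *)
have D_of_geq u v : geq d u v -> D (v ++ rev u).
  by move=> /geqD/(_ [::] (rev u)) [H _]; apply/H/(word_rev_ins D0 Dins).
(* The word [v ++ rev u] lies in [D], hence in [E]; multiplied by [u] it cancels to [v]. *)
have geqE u v : geq d u v -> E u -> E v.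
  move=> /D_of_geq/DE Evu /(Ecat _ _ Evu); rewrite -catA.
  by rewrite -{2}[u]revK -[rev (rev u)]cats0 => /(word_del Edel); rewrite cats0.
(* [n] divides [d] because the [d]-th power of [xy] lies in [D], hence in [E]. *)
exists d, n; split; first exact/nP/DE.
have D_geq w : D w -> geq d w [::].
  move=> Dw; have [k wk] := geq_normal d (one_block_even evenC Dw).
  have Dk v : geq d w v -> D v by move/geqD/(_ [::] [::]); rewrite /= !cats0 => <-.
  have dk : d %| k.
    case: wk => /Dk; first by move/dP.
    by rewrite -rev_xy_pow => /Drev; rewrite revK => /dP.
  case/dvdnP: dk wk => q ->; rewrite mulnC => -[wk|wk]; apply: geq_trans wk _.
    exact: geq_xy_mul.
  exact: geq_yx_mul.
have E_Lambda w : E w -> in_Lambda d n w.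
  move=> Ew; have [k wk] := geq_normal d (two_block_even evenC Ew).
  have nk : n %| k.
    case: wk => /geqE/(_ Ew); first by move/nP.
    by rewrite -rev_xy_pow => /Erev; rewrite revK => /nP.
  by case/dvdnP: nk wk => q ->; rewrite mulnC; exists q.
have Lambda_E w : in_Lambda d n w -> E w.
  case=> k []/geq_sym/geqE; apply; first by apply/nP; exact: dvdn_mulr.
  by rewrite -rev_xy_pow; apply: Erev; apply/nP; exact: dvdn_mulr.
have clG := gen_precategory
  (fun q => C_Gamma d q \/ exists w, in_Lambda d n w /\ q = beta_part w w).
move=> q; split=> [Cq|].
  have [s rq] := encodes_exists (cat_nc catC Cq).1.
  apply: (row_of_encodes clG rq).
  apply: (row_sub_generated catC clG M); last exact: encodes_row rq Cq.
    by move=> w /D_geq gw; apply: gen_base; left; apply: one_block_C_Gamma.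
  move=> w /E_Lambda wL; apply: (encodes_row clG (beta_encodes w)).
  by apply: gen_base; right; exists w.
apply: gen_sub => // {}q [[pq ncq gq]|[w [wL ->]]]; last first.
  by apply: (row_of_encodes clC (beta_encodes w)); apply: Lambda_E.
have [s rq] := encodes_exists pq; apply: (row_of_encodes clC rq).
(* For a member of [C_Gamma], it is enough to treat each block, whose word lies in [D] by the
   equality of its upper and lower products. *)
apply: row_of_blocks => //; first exact: encodes_nc rq ncq.
move=> l ls; have [x vx <-] := encodes_pt rq ls.
by rewrite (encodes_word rq vx); apply: D_of_geq; apply: gq.
Qed.
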